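(* Assume (A1), and assume (C3) holds for some $p>2$. Suppose $h_n=n^{-\theta_2}(\log n)^{\theta_1}$ for some $\theta_1,\theta_2>0$. Let $a,b\ge0$ and set $$v_n=\frac{n^a(\log n)^b}{(nh_n)^{d/2}},\qquad \theta=\frac{2a(d+p)-d^2-2}{d(3d+2)}.$$ If $\theta\ge\theta_2$ and $d(3d+2)\theta_1+2(d+p)b>2$, then $$\sup_{x\in[0,1]^d}|g_n(x)-Eg_n(x)|=O_{a.s.}[v_n].$$
   Context: Fix an integer $d\ge1$. For $x=(x_1,\dots,x_d)\in\mathbb{R}^d$ let $\|x\|=\max_{1\le k\le d}|x_k|$; for $i,j\in\mathbb{Z}^d$ let $|i-j|=\max_{1\le l\le d}|i_l-j_l|$, and $|k|=|k-0|$. Let $(\varepsilon_i)_{i\in\mathbb{Z}^d}$ be a strictly stationary real random field on a probability space $(\Omega,\mathcal F,\mathbb P)$ with $E\varepsilon_0=0$. Strict stationarity means: for all $k\in\mathbb{Z}^d$, $n\ge1$ and $i_1,\dots,i_n\in\mathbb{Z}^d$, the vectors $(\varepsilon_{i_1},\dots,\varepsilon_{i_n})$ and $(\varepsilon_{i_1+k},\dots,\varepsilon_{i_n+k})$ have the same law. Let $g:[0,1]^d\to\mathbb{R}$ and $\Lambda_n=\{1,\dots,n\}^d$, and set $Y_i=g(i/n)+\varepsilon_i$ for $i\in\Lambda_n$. Let $K$ be a probability density on $\mathbb{R}^d$ and $(h_n)_{n\ge1}$ positive numbers with $h_n\to0$ and $nh_n\to\infty$. For $x\in[0,1]^d$ define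 $$g_n(x)=\frac{\sum_{i\in\Lambda_n}Y_i\,K\big((x-i/n)/h_n\big)}{\sum_{i\in\Lambda_n}K\big((x-i/n)/h_n\big)}.$$ Assumption (A1): $K$ is symmetric and nonnegative, and supported in $[-1,1]^d$. There is $\eta>0$ with $|K(x)-K(y)|\le\eta\|x-y\|$ for all $x,y\in[-1,1]^d$, and there are constants $c,C>0$ with $c\le K(x)\le C$ for all $x\in[-1,1]^d$. Notation $O_{a.s.}$: for real random variables $Z_n$ and positive numbers $v_n$, $Z_n=O_{a.s.}[v_n]$ means there exists a deterministic $\lambda>0$ with $\limsup_{n\to\infty}|Z_n|/v_n\le\lambda$ almost surely. Dependence notation: $i<_{lex}j$ for distinct $i,j\in\mathbb{Z}^d$ means either $i_1<j_1$, or for some $p\in\{2,\dots,d\}$ one has $i_p<j_p$ and $i_q=j_q$ for $1\le q<p$. Set $V_i^1=\{j\in\mathbb{Z}^d: j<_{lex}i\}$ and, for integers $m\ge2$, $V_i^m=V_i^1\cap\{j:|i-j|\ge m\}$. For $\Gamma\subset\mathbb{Z}^d$ let $\mathcal F_\Gamma=\sigma(\varepsilon_j: j\in\Gamma)$. For $k\in V_0^1$ (so $|k|\ge1$) put $E_{|k|}(\varepsilon_0)=E(\varepsilon_0\mid\mathcal F_{V_0^{|k|}})$. Condition (C3) (for a given $p>2$): $\varepsilon_0\in L^p$ and $\sum_{k\in V_0^1}\|\varepsilon_kE_{|k|}(\varepsilon_0)\|_{p/2}<\infty$. *)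

(* Defs.v *)
From HB Require Import structures.
From mathcomp Require Import all_boot all_order all_algebra.
From mathcomp Require Import all_classical all_reals all_analysis.
Set Implicit Arguments.
Unset Strict Implicit.
Unset Printing Implicit Defensive.
Import Order.TTheory GRing.Theory Num.Theory.
Import numFieldNormedType.Exports.
Local Open Scope classical_set_scope.
Local Open Scope ring_scope.

Definition Zd (d : nat) := {ffun 'I_d -> int}.
Definition zd0 (d : nat) : Zd d := [ffun _ => 0%Z].
Definition zdadd (d : nat) (i k : Zd d) : Zd d := [ffun l => i l + k l].
Definition zdist (d : nat) (i j : Zd d) : nat := \max_(l < d) `|i l - j l|%N.

Definition lex_lt (d : nat) (i j : Zd d) : Prop :=
  exists p : 'I_d, (i p < j p)%R /\ forall q : 'I_d, (q < p)%N -> i q = j q.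

(* V_i^m = V_i^1 ∩ {j : |i - j| >= m}  (for m = 1 the extra condition is automatic) *)
Definition Vset (d : nat) (i : Zd d) (m : nat) : set (Zd d) :=
  [set j | lex_lt j i /\ (m <= zdist i j)%N].

Section field.
Context {R : realType} {dO : measure_display} {Omega : measurableType dO}.

Definition sigma_field (d : nat) (eps : Zd d -> Omega -> R) (Gamma : set (Zd d))
  : set (set Omega) :=
  <<s setT, [set A | exists j, Gamma j /\
        exists B : set R, measurable B /\ A = eps j @^-1` B] >>.

Definition is_cond_exp (P : probability Omega R) (G : set (set Omega))
  (X Z : Omega -> R) : Prop :=
  [/\ forall B : set R, measurable B -> G (Z @^-1` B),
      P.-integrable setT (EFin \o Z)
    & forall A, G A -> (\int[P]_(w in A) (Z w)%:E = \int[P]_(w in A) (X w)%:E)%E].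

(* strict stationarity: equality of all finite-dimensional distributions
   (tested on measurable rectangles) under translations *)
Definition strictly_stationary (P : probability Omega R) (d : nat)
  (eps : Zd d -> Omega -> R) : Prop :=
  forall (k : Zd d) (n : nat) (idx : 'I_n -> Zd d) (B : 'I_n -> set R),
    (forall m, measurable (B m)) ->
    P [set w | forall m, B m (eps (idx m) w)] =
    P [set w | forall m, B m (eps (zdadd (idx m) k) w)].

Definition cond_C3 (P : probability Omega R) (d : nat)
  (eps : Zd d -> Omega -> R) (p : R) : Prop :=
  (Lnorm P p%:E (EFin \o eps (zd0 d)) < +oo)%E /\
  exists Z : nat -> Omega -> R,
    (forall m, (1 <= m)%N ->
       is_cond_exp P (sigma_field eps (Vset (zd0 d) m)) (eps (zd0 d)) (Z m)) /\
    (\esum_(k in Vset (zd0 d) 1)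
        Lnorm P (p / 2)%:E (fun w => (eps k w * Z (zdist (zd0 d) k) w)%:E)
      < +oo)%E.
End field.

Section kernel.
Context {R : realType}.

Fixpoint cube_int (d : nat) (F : (nat -> R) -> \bar R) : \bar R :=
  match d with
  | 0 => F (fun _ => 0)
  | d'.+1 => (\int[@lebesgue_measure R]_(t in `[(-1)%R, 1%R])
                 cube_int d' (fun x => F (fun i => if i == d' then t else x i)))%E
  end.

Definition supnorm (d : nat) (x : 'I_d -> R) : R := \big[Num.max/0]_(l < d) `|x l|.

Definition cube (d : nat) (lo hi : R) : set ('I_d -> R) :=
  [set x | forall l, lo <= x l <= hi].

Definition assumption_A1 (d : nat) (K : ('I_d -> R) -> R) : Prop :=
  [/\ (forall x, 0 <= K x),
      cube_int d (fun x => (K (fun l => x (nat_of_ord l)))%:E) = 1%E /\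
      (forall x, K (fun l => - x l) = K x),
      (forall x, ~ cube (-1) 1 x -> K x = 0),
      (exists eta : R, 0 < eta /\ forall x y, cube (-1) 1 x -> cube (-1) 1 y ->
          `|K x - K y| <= eta * supnorm (fun l => x l - y l))
    & (exists c C : R, [/\ 0 < c, 0 < C &
          forall x, cube (-1) 1 x -> c <= K x <= C])].

(* the point i/n for i in Lambda_n = {1..n}^d, encoded by i' : 'I_d -> 'I_n, i = i' + 1 *)
Definition lam_idx (d n : nat) (i : {ffun 'I_d -> 'I_n}) : Zd d :=
  [ffun l => ((nat_of_ord (i l)).+1)%:Z].
Definition lam_pt (d n : nat) (i : {ffun 'I_d -> 'I_n}) : 'I_d -> R :=
  fun l => ((nat_of_ord (i l)).+1)%:R / n%:R.

Definition kweight (d n : nat) (K : ('I_d -> R) -> R) (h : R) (x : 'I_d -> R)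
  (i : {ffun 'I_d -> 'I_n}) : R :=
  K (fun l => (x l - lam_pt i l) / h).

Definition g_est {T : Type} (d : nat) (g : ('I_d -> R) -> R) (eps : Zd d -> T -> R)
  (K : ('I_d -> R) -> R) (h : nat -> R) (n : nat) (x : 'I_d -> R) (w : T) : R :=
  (\sum_(i : {ffun 'I_d -> 'I_n})
      (g (lam_pt i) + eps (lam_idx i) w) * kweight K (h n) x i) /
  (\sum_(i : {ffun 'I_d -> 'I_n}) kweight K (h n) x i).
End kernel.

(* Main.v *)
(** The numerator of [g_n - E g_n] is a weighted sum of the noise over the box where the kernel lives.

    Moments. Order the sites lexicographically and add them one at a time. In the Taylor expansion of
    [|S|^p] the linear term [E (psi(S) eps_i)] is telescoped by deleting the sites of [S] in order of
    increasing distance to [i]; each increment is measurable with respect to sites far from [i], so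
    [eps_i] may be replaced by its conditional expectation, and Hoelder's inequality with (C3) gives
    [E |S|^p <= (C m^2 N)^(p/2)] for [N] sites and weights bounded by [m].

    Maxima. As [p > 2], dyadic doubling in each direction in turn bounds the maximum over all prefix
    boxes of a block at the same order. This absorbs the jump of the kernel at the boundary of its
    support: moving [x] inside a small cell only changes the box (controlled by the maximum) and the
    values of the kernel (controlled by its Lipschitz constant times the sum of the [|eps_i|]).

    Summation. Cover the unit cube by cells of width [v_n h_n^(2d+1)]. Markov's inequality and the
    union bound lead to a series whose general term is at most [1 / (n ln^(1+t) n)]; the hypotheses on
    [theta] and on [theta1], [b] are exactly what this requires. *)

Require Import Defs.
From HB Require Import structures.
From mathcomp Require Import all_boot all_order all_algebra.
From mathcomp Require Import all_classical all_reals all_analysis.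
From mathcomp Require Import measurable_realfun.
From mathcomp Require Import ring lra zify.
Import Order.TTheory GRing.Theory Num.Theory.
Import numFieldNormedType.Exports.
Import HBSimple HBNNSimple.
Local Open Scope classical_set_scope.
Local Open Scope ring_scope.
Set Implicit Arguments.
Unset Strict Implicit.
Unset Printing Implicit Defensive.

(** * Power inequalities *)

Section power_inequalities.
Context {R : realType}.
Implicit Types x y p : R.

(** The cell width [v * h ^+ (2 * d).+1] balances two costs. Inside a cell the rescaled kernel
    argument moves by [delta / h]; it acts on about $n^d$ values $|\varepsilon_i|$ and is divided by
    a kernel sum of order $(nh)^d$, which leaves $v h^d$ times their mean. The spare $h^d$ pays for
    a bound on that mean which loses $\ln^2 n$. The price is about $(v h^{2d+1})^{-d}$ cells, each
    with a Markov factor $((nh)^{d/2} v)^{-p}$. Inserting $h$ and $v$, the power of $n$ in the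
    product is $-a(d+p)+d^2/2+\theta_2 d(3d+2)/2$ and that of $\ln n$ is $-b(d+p)-\theta_1
    d(3d+2)/2$: this is the origin of $d(3d+2)$ and $d+p$. The moment bound is self-referential:
    Hoelder's inequality returns the largest moment [m] over subsets to the power [(p - 2) / p], and
    the resulting inequality is solved for [m]. The supremum over $x$ is never integrated. For each
    $n$ one integrable [f] is built such that [f w <= 1] forces the bound at all $x$; the integrals
    are summable, so almost surely [f w <= 1] from some $n$ on. *)

Definition psi p x : R := x * `|x| `^ (p - 2).

Lemma normrM_powR p x : 0 < p -> `|x| * `|x| `^ (p - 1) = `|x| `^ p.
Proof. by move=> p0; rewrite mulr_powRB1. Qed.

Lemma norm_psi p x : 2 < p -> `|psi p x| = `|x| `^ (p - 1).
Proof.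
move=> p2; rewrite /psi normrM (ger0_norm (powR_ge0 _ _)).
have -> : p - 2 = (p - 1) - 1 by ring.
by rewrite normrM_powR//; lra.
Qed.

Lemma psiM p x : 2 < p -> psi p x * x = `|x| `^ p.
Proof.
move=> p2; rewrite /psi mulrAC -expr2 -real_normK ?num_real// expr2 -mulrA.
have -> : p - 2 = (p - 1) - 1 by ring.
by rewrite !normrM_powR//; lra.
Qed.

(** Young's inequality with exponents [q / (q - 1)] and [q], cleared of denominators; rearranged, it
    is the tangent-line inequality of the [q]-th power at [y]. *)
Lemma young_powR q x y : 1 < q -> 0 <= x -> 0 <= y ->
  q * (y `^ (q - 1) * x) <= (q - 1) * y `^ q + x `^ q.
Proof.
move=> q1 x0 y0.
have q0 : 0 < q by lra.
have qm : 0 < q / (q - 1) by rewrite divr_gt0//; lra.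
have := @conjugate_powR R (y `^ (q - 1)) x (q / (q - 1)) q (powR_ge0 _ _) x0 qm q0.
have E : (q / (q - 1))^-1 + q^-1 = 1.
  by rewrite invf_div; field; lra.
move=> /(_ E); rewrite -powRrM.
have -> : (q - 1) * (q / (q - 1)) = q by field; lra.
rewrite -(@ler_pM2l _ q q0 (_ * _)) => H; apply: le_trans H _.
rewrite le_eqVlt; apply/orP; left; apply/eqP.
by field; lra.
Qed.

Lemma powR_tangent q x y : 1 < q -> 0 <= x -> 0 <= y ->
  y `^ q - x `^ q <= q * (y `^ (q - 1) * (y - x)).
Proof.
move=> q1 x0 y0; have := young_powR q1 x0 y0.
have : y `^ q = y `^ (q - 1) * y by rewrite mulrC mulr_powRB1//; lra.
move: (y `^ q) (x `^ q) (y `^ (q - 1)) => A B C -> H.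
by rewrite mulrBr mulrBr; lra.
Qed.

(** Convexity of [|x| ^ p], whose derivative is [p * psi p x]. *)
Lemma psi_tangent p x y : 2 < p ->
  `|y| `^ p - `|x| `^ p <= p * (psi p y * (y - x)).
Proof.
move=> p2.
have p1 : 1 < p by lra.
have := @young_powR p `|x| `|y| p1 (normr_ge0 _) (normr_ge0 _).
rewrite mulrBr psiM// => H.
have : psi p y * x <= `|y| `^ (p - 1) * `|x|.
  by apply: le_trans (ler_norm _) _; rewrite normrM norm_psi.
rewrite -(@ler_pM2l _ p); last by lra.
by rewrite mulrBr; lra.
Qed.

Lemma psi_lip_ge0 p x y : 2 < p -> 0 <= x -> x <= y ->
  psi p y - psi p x <= (p - 1) * ((y - x) * (`|x| `^ (p - 2) + `|y| `^ (p - 2))).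
Proof.
move=> p2 x0 xy; have y0 := le_trans x0 xy.
have p1 : 1 < p - 1 by lra.
have := powR_tangent p1 x0 y0.
have -> : p - 1 - 1 = p - 2 by ring.
rewrite /psi !ger0_norm//.
have E z : 0 <= z -> z `^ (p - 1) = z * z `^ (p - 2).
  move=> z0; have -> : p - 2 = p - 1 - 1 by ring.
  by rewrite mulr_powRB1//; lra.
rewrite !E// => /le_trans; apply.
rewrite ler_wpM2l//; first by lra.
rewrite mulrC ler_wpM2l ?subr_ge0//.
by rewrite lerDr powR_ge0.
Qed.

Lemma psiN p x : psi p (- x) = - psi p x.
Proof. by rewrite /psi normrN mulNr. Qed.

Lemma psi_lip_le p x y : 2 < p -> x <= y ->
  `|psi p y - psi p x| <= (p - 1) * ((y - x) * (`|x| `^ (p - 2) + `|y| `^ (p - 2))).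
Proof.
move=> p2 xy.
have psi_ge0 z : 0 <= z -> 0 <= psi p z by move=> z0; rewrite mulr_ge0// powR_ge0.
have psi_mono : psi p x <= psi p y.
  have mono u v : 0 <= u -> u <= v -> psi p u <= psi p v.
    move=> u0 uv; have v0 := le_trans u0 uv.
    rewrite /psi !ger0_norm//; apply: ler_pM => //; first exact: powR_ge0.
    by apply: ge0_ler_powR => //; lra.
  have [x0|x0] := leP 0 x; first exact: mono.
  have [y0|y0] := leP 0 y.
    apply: (@le_trans _ _ 0); last exact: psi_ge0.
    by rewrite -oppr_ge0 -psiN psi_ge0//; lra.
  by rewrite -lerN2 -!psiN mono//; lra.
rewrite ger0_norm ?subr_ge0//.
have [x0|x0] := leP 0 x; first exact: psi_lip_ge0.
have [y0|y0] := leP 0 y; last first.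
  have := @psi_lip_ge0 p (- y) (- x) p2.
  rewrite !psiN !normrN => /(_ _ _)/le_trans.
  have -> : psi p y - psi p x = - psi p x - - psi p y by ring.
  apply; rewrite ?oppr_ge0 ?lerN2//; first exact: ltW.
  have -> : - x - - y = y - x by ring.
  by rewrite [X in _ * (_ * X)]addrC.
(* Opposite signs: [psi p y] and [- psi p x] are both nonnegative and are bounded separately, so the
   factor [p - 1 >= 1] is only thrown in. *)
rewrite /psi.
have A0 := powR_ge0 `|x| (p - 2); have B0 := powR_ge0 `|y| (p - 2).
move: (`|x| `^ _) (`|y| `^ _) A0 B0 => A B A0 B0.
apply: (@le_trans _ _ ((y - x) * (A + B))); last first.
  have p1 : 1 <= p - 1 by lra.
  by rewrite (ler_peMl _ p1)// mulr_ge0 ?subr_ge0// addr_ge0.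
nra.
Qed.

Lemma psi_lip p x y : 2 < p ->
  `|psi p y - psi p x| <= (p - 1) * (`|y - x| * (`|x| `^ (p - 2) + `|y| `^ (p - 2))).
Proof.
move=> p2; have [xy|yx] := leP x y.
  by rewrite [in leRHS]ger0_norm ?subr_ge0// psi_lip_le.
rewrite distrC (distrC y) (ger0_norm (_ : 0 <= x - y)); last by rewrite subr_ge0 ltW.
by rewrite [X in _ * (_ * X)]addrC psi_lip_le// ltW.
Qed.

(** No second derivative is taken: [psi_tangent] compares with the slope at [y], and [psi_lip] pays
    for replacing it by the slope at [x]. *)
Lemma powR_taylor p x y : 2 < p ->
  `|y| `^ p - `|x| `^ p - p * (psi p x * (y - x)) <=
  p * ((p - 1) * ((y - x) ^+ 2 * (`|x| `^ (p - 2) + `|y| `^ (p - 2)))).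
Proof.
move=> p2; have T := psi_tangent x y p2; have L := psi_lip x y p2.
apply: (@le_trans _ _ (p * (`|psi p y - psi p x| * `|y - x|))).
  apply: (@le_trans _ _ (p * ((psi p y - psi p x) * (y - x)))).
    by rewrite mulrBl; lra.
  by rewrite ler_wpM2l//; [lra | rewrite -normrM ler_norm].
rewrite ler_wpM2l//; first by lra.
apply: le_trans (ler_wpM2r (normr_ge0 _) L) _.
rewrite -[(y - x) ^+ 2]real_normK ?num_real//.
by rewrite le_eqVlt; apply/orP; left; apply/eqP; ring.
Qed.

(* Minkowski's inequality for exponent [p], in the pointwise form obtained from convexity. *)
Lemma powRD_le p s t x y : 1 <= p -> 0 < s -> 0 < t -> 0 <= x -> 0 <= y ->
  (x + y) `^ p <= (s + t) `^ p * ((s / (s + t)) * (x / s) `^ p + (t / (s + t)) * (y / t) `^ p).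
Proof.
move=> p1 s0 t0 x0 y0.
have st : 0 < s + t by rewrite addr_gt0.
have cv := @convex_powR R p p1.
have l01 : 0 <= s / (s + t) <= 1.
  apply/andP; split; first by rewrite divr_ge0// ltW.
  by rewrite ler_pdivrMr// mul1r lerDl ltW.
have xs : 0 <= x / s by rewrite divr_ge0// ltW.
have yt : 0 <= y / t by rewrite divr_ge0// ltW.
have := cv (Itv01 (proj1 (andP l01)) (proj2 (andP l01))) (x / s) (y / t).
rewrite !in_setE /= => /(_ _ _).
rewrite /conv /= => H.
have {}H : (s / (s + t) * (x / s) + (1 - s / (s + t)) * (y / t)) `^ p <=
  s / (s + t) * (x / s) `^ p + (1 - s / (s + t)) * (y / t) `^ p.
  by apply: H; rewrite in_itv/= ?xs ?yt ?andbT.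
have E : 1 - s / (s + t) = t / (s + t) by field; lra.
rewrite E in H.
have -> : x + y = (s + t) * (s / (s + t) * (x / s) + t / (s + t) * (y / t)).
  by field; rewrite !gt_eqF.
have w0 : 0 <= s / (s + t) * (x / s) + t / (s + t) * (y / t).
  by rewrite addr_ge0// mulr_ge0// divr_ge0// ltW.
by rewrite (powRM _ (ltW st) w0) ler_wpM2l// powR_ge0.
Qed.

End power_inequalities.

(** * Conditional expectation *)

Section conditional_expectation.
Context {R : realType} {dO : measure_display} {Omega : measurableType dO}.
Context (P : probability Omega R) (C : set (set Omega)).
Context (Cm : C `<=` measurable).
Implicit Types X Z f : Omega -> R.

Local Notation itg f := (P.-integrable setT (EFin \o f)).
Local Notation G := <<s setT, C >>.

Lemma sub_sigma_measurable : G `<=` @measurable _ Omega.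
Proof. by apply: smallest_sub => //; exact: sigma_algebra_measurable. Qed.

Lemma integral_setE (A : set Omega) X :
  (\int[P]_(w in A) (X w)%:E = \int[P]_w (\1_A w * X w)%:E)%E.
Proof.
rewrite integral_mkcond; apply: eq_integral => w _.
by rewrite patchE indicE; case: ifPn => _ /=; rewrite ?mul1r ?mul0r.
Qed.

Local Notation TG := (g_sigma_algebraType C).

Lemma itg_bounded_mul f X (M : R) : measurable_fun setT f ->
  (forall w, `|f w| <= M) -> itg X -> itg (fun w => f w * X w).
Proof.
move=> mf fM iX.
have mX : measurable_fun setT X by case/integrableP: iX => /measurable_EFinP.
apply: (@le_integrable _ _ _ _ _ _ _ (EFin \o (fun w => M * X w))) => //.
- by apply/measurable_EFinP; exact: measurable_funM.
- move=> w _ /=; rewrite !lee_fin !normrM ler_wpM2r//.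
  exact: le_trans (fM w) (ler_norm _).
- have -> : EFin \o (fun w => M * X w) = (fun w => M%:E * (EFin \o X) w)%E.
    by apply/funext => w; rewrite /= EFinM.
  exact: integrableZl.
Qed.

Lemma nnsfun_pull_out (s : {nnsfun TG >-> R}) X Z : itg X -> itg Z ->
  (forall A, G A -> (\int[P]_(w in A) (Z w)%:E = \int[P]_(w in A) (X w)%:E)%E) ->
  (\int[P]_w (s w * Z w)%:E = \int[P]_w (s w * X w)%:E)%E.
Proof.
move=> iX iZ ZX.
pose A (y : R) : set Omega := s @^-1` [set y].
have GA y : G (A y).
  have : measurable (s @^-1` [set y]).
    by rewrite -[X in measurable X]setTI; exact: measurable_funP.
  by [].
have mA y : measurable (A y) by exact: sub_sigma_measurable.
have main X' : itg X' -> (\int[P]_w (s w * X' w)%:E =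
   \sum_(y <- finmap.enum_fset (fset_set (range s))) y%:E * \int[P]_(w in A y) (X' w)%:E)%E.
  move=> iX'.
  have i1 y : itg (fun w => \1_(A y) w * X' w).
    apply: (@itg_bounded_mul _ _ 1) => //.
    by move=> w; rewrite indicE; case: (_ \in _); rewrite ?normr1 ?normr0.
  have -> : (fun w => (s w * X' w)%:E) =
     (fun w => \sum_(y <- finmap.enum_fset (fset_set (range s))) (y%:E * (\1_(A y) w * X' w)%:E))%E.
    apply/funext => w; rewrite [s w](fimfunE s) fsbig_finite//=.
    rewrite mulr_suml -sumEFin; apply: eq_bigr => y _.
    by rewrite -EFinM mulrA.
  rewrite (@integral_sum _ _ _ P setT measurableT _
    (fun y w => (y%:E * (\1_(A y) w * X' w)%:E)%E)); last first.
    by move=> y; apply: integrableZl => //; exact: i1.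
  apply: eq_bigr => y _; rewrite integral_setE.
  exact: (@integralZl _ _ _ P setT measurableT (EFin \o (fun w => \1_(A y) w * X' w)) (i1 y) y).
by rewrite !main//; apply: eq_bigr => y _; rewrite ZX.
Qed.

(** The simple approximants are taken on [TG], the space carrying [G] as its sigma-algebra, so that
    their level sets lie in [G]; the limit is by dominated convergence under [|f * X|] and
    [|f * Z|]. *)
Lemma ge0_pull_out f X Z : (forall w, 0 <= f w) ->
  (forall B : set R, measurable B -> G (f @^-1` B)) ->
  itg X -> itg Z -> itg (fun w => f w * X w) -> itg (fun w => f w * Z w) ->
  (forall A, G A -> (\int[P]_(w in A) (Z w)%:E = \int[P]_(w in A) (X w)%:E)%E) ->
  (\int[P]_w (f w * Z w)%:E = \int[P]_w (f w * X w)%:E)%E.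
Proof.
move=> f0 fG iX iZ ifX ifZ ZX.
have mf : @measurable_fun _ _ (TG : measurableType _) _ setT (EFin \o f).
  by apply/measurable_EFinP => _ B mB; rewrite setTI; exact: fG.
pose s_ := nnsfun_approx (@measurableT _ TG) mf.
have ms n : measurable_fun setT (s_ n : Omega -> R).
  move=> _ B mB; rewrite setTI; apply: sub_sigma_measurable.
  have : measurable (s_ n @^-1` B) by exact: measurable_funPTI.
  by [].
have cvg X' : itg X' -> itg (fun w => f w * X' w) ->
  ((fun n => \int[P]_w (s_ n w * X' w)%:E) @ \oo --> \int[P]_w (f w * X' w)%:E)%E.
  move=> iX' ifX'.
  have mX' : measurable_fun setT X' by case/integrableP: iX' => /measurable_EFinP.
  apply: (proj2 (and3_rec (fun a b c => conj b c) (@dominated_convergence _ _ _ P setT measurableT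
    (fun n w => (s_ n w * X' w)%:E) (fun w => (f w * X' w)%:E)
    (fun w => `|(f w * X' w)%:E|)%E _ _ _ _ _))).
  - by move=> n; apply/measurable_EFinP; exact: measurable_funM.
  - by case/integrableP: ifX'.
  - apply: aeW => w _.
    under eq_fun do rewrite EFinM.
    rewrite EFinM; apply: cvgeZr => //.
    apply: cvg_nnsfun_approx => // x _; rewrite lee_fin; exact: f0.
  - exact: integrable_abse.
  - apply: aeW => w n _ /=; rewrite lee_fin !normrM ler_wpM2r//.
    rewrite !ger0_norm// -lee_fin /s_ nnsfun_approxE.
    by apply: (@le_approx _ TG R setT (EFin \o f)) => // x _; rewrite lee_fin.
have c1 := cvg _ iZ ifZ; have c2 := cvg _ iX ifX.
have E : (fun n => \int[P]_w (s_ n w * Z w)%:E)%E = (fun n => \int[P]_w (s_ n w * X w)%:E)%E.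
  by apply/funext => n; exact: nnsfun_pull_out.
by rewrite E in c1; exact: cvg_unique c1 c2.
Qed.

(** Extends the defining identity from indicators of sets in [G] to unbounded [f]; the two products
    are assumed integrable because this does not follow from the integrability of [X] and [Z]. *)
Lemma cond_exp_pull_out f X Z : is_cond_exp P G X Z -> itg X ->
  (forall B : set R, measurable B -> G (f @^-1` B)) ->
  itg (fun w => f w * X w) -> itg (fun w => f w * Z w) ->
  (\int[P]_w (f w * Z w)%:E = \int[P]_w (f w * X w)%:E)%E.
Proof.
move=> [_ iZ ZX] iX fG ifX ifZ.
have mf : measurable_fun setT f.
  by move=> _ B mB; rewrite setTI; apply: sub_sigma_measurable; exact: fG.
(* [g] will be the positive or the negative part; the bound by [|x|] hands the integrability of the
   products with [f] on to those with [g \o f]. *)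
have part (g : R -> R) : measurable_fun setT g -> (forall x, 0 <= g x <= `|x|) ->
    (forall X', measurable_fun setT X' -> itg (fun w => f w * X' w) -> itg (fun w => g (f w) * X' w))
    /\ (\int[P]_w (g (f w) * Z w)%:E = \int[P]_w (g (f w) * X w)%:E)%E.
  move=> mg g0.
  have ig X' : measurable_fun setT X' -> itg (fun w => f w * X' w) -> itg (fun w => g (f w) * X' w).
    move=> mX'; apply: le_integrable => //.
      by apply/measurable_EFinP; apply: measurable_funM => //; exact: measurableT_comp.
    move=> w _ /=; rewrite lee_fin !normrM ler_wpM2r//.
    by have /andP[a b] := g0 (f w); rewrite ger0_norm.
  have mX : measurable_fun setT X by case/integrableP: iX => /measurable_EFinP.
  have mZ : measurable_fun setT Z by case/integrableP: iZ => /measurable_EFinP.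
  split=> //; apply: ge0_pull_out => //; [| |exact: ig|exact: ig].
  - by move=> w; have /andP[] := g0 (f w).
  - move=> B mB; have -> : (fun w => g (f w)) @^-1` B = f @^-1` (g @^-1` B) by [].
    by apply: fG; rewrite -[_ @^-1` _]setTI; exact: mg.
have max_ge0 (x y : R) : `|y| = `|x| -> 0 <= Num.max y 0 <= `|x|.
  by move=> <-; rewrite le_max lexx orbT ge_max normr_ge0 ler_norm.
have mmax : measurable_fun setT (fun x : R => Num.max x 0) by exact: measurable_maxr.
have mmaxN : measurable_fun setT (fun x : R => Num.max (- x) 0).
  by apply: measurable_maxr => //; exact: measurableT_comp.
have [i1 e1] := part _ mmax (fun x => max_ge0 x x erefl).
have [i2 e2] := part _ mmaxN (fun x => max_ge0 x (- x) (normrN x)).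
have mX : measurable_fun setT X by case/integrableP: iX => /measurable_EFinP.
have mZ : measurable_fun setT Z by case/integrableP: iZ => /measurable_EFinP.
have main X' : measurable_fun setT X' -> itg (fun w => f w * X' w) ->
  (\int[P]_w (f w * X' w)%:E = \int[P]_w (Num.max (f w) 0 * X' w)%:E -
   \int[P]_w (Num.max (- f w) 0 * X' w)%:E)%E.
  move=> mX' ifX'.
  rewrite -integralB//; [|exact: i1|exact: i2].
  apply: eq_integral => w _; rewrite -EFinB -mulrBl; congr (_ * _)%:E.
  by rewrite /Num.max; case: ltP => ?; case: ltP => ?; lra.
by rewrite !main// e1 e2.
Qed.

End conditional_expectation.

(** * Stationarity *)

Section stationary_law.
Context {R : realType} {I : finType}.

Definition rectangles : set (set (I -> R)) :=
  [set A | exists2 B : I -> set R, (forall i, measurable (B i)) &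
    A = [set x | forall i, B i (x i)]].

(** The product sigma-algebra, presented through the very sets on which [strictly_stationary]
    compares laws. *)
Definition rectType : measurableType _ := g_sigma_algebraType rectangles.

Lemma rectangles_setI : setI_closed rectangles.
Proof.
move=> _ _ [A mA ->] [B mB ->]; exists (fun i => A i `&` B i).
  by move=> i; exact: measurableI.
apply/seteqP; split=> x /=; first by move=> [a b] i; split.
by move=> ab; split=> i; have [] := ab i.
Qed.

Lemma rectangles_setT : rectangles setT.
Proof. by exists (fun=> setT) => //; apply/seteqP; split. Qed.

Lemma measurable_coord (i : I) : measurable_fun setT (fun x : rectType => x i).
Proof.
move=> _ B mB; rewrite setTI; apply: sub_sigma_algebra.
exists (fun j => if j == i then B else setT); first by move=> j; case: ifP.
apply/seteqP; split=> x /=; first by move=> Bx j; case: eqP => // ->.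
by move=> /(_ i); rewrite eqxx.
Qed.

Context {dO : measure_display} {Omega : measurableType dO}.
Context (P : probability Omega R).

Lemma measurable_rect (X : I -> Omega -> R) : (forall i, measurable_fun setT (X i)) ->
  measurable_fun setT (fun w => (X ^~ w) : rectType).
Proof.
move=> mX; apply: (@measurability _ _ Omega rectType _ _ rectangles erefl).
move=> _ [_ [B mB ->] <-]; rewrite setTI.
have -> : (fun w => X ^~ w) @^-1` [set x | forall i, B i (x i)] =
    \bigcap_(i in [set: I]) (X i @^-1` B i).
  by apply/seteqP; split=> w /= H i; [move=> _; exact: H | exact: H].
apply: fin_bigcap_measurable => // i _.
by rewrite -[_ @^-1` _]setTI; exact: mX.
Qed.

(** Rectangles are stable under intersection and generate, so two finite measures that agree on them
    agree; the integral of any measurable functional of the vector then depends on its law alone. *)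
Lemma integral_law (X Y : I -> Omega -> R) (F : rectType -> \bar R) :
  (forall i, measurable_fun setT (X i)) -> (forall i, measurable_fun setT (Y i)) ->
  (forall B : I -> set R, (forall i, measurable (B i)) ->
    P [set w | forall i, B i (X i w)] = P [set w | forall i, B i (Y i w)]) ->
  measurable_fun setT F ->
  (\int[P]_w F (X ^~ w) = \int[P]_w F (Y ^~ w))%E.
Proof.
move=> mX mY XY mF.
have mX' := measurable_rect mX; have mY' := measurable_rect mY.
pose X' : {mfun Omega >-> rectType} := HB.pack (fun w => (X ^~ w) : rectType)
  (isMeasurableFun.Build _ _ _ _ _ mX').
pose Y' : {mfun Omega >-> rectType} := HB.pack (fun w => (Y ^~ w) : rectType)
  (isMeasurableFun.Build _ _ _ _ _ mY').
have mu_eq A : measurable A -> pushforward P X' A = pushforward P Y' A.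
  apply: (@measure_unique _ R rectType rectangles (fun=> setT)) => //.
  - exact: rectangles_setI.
  - by move=> _; exact: rectangles_setT.
  - by rewrite bigcup_const.
  - by move=> _ [B mB ->]; rewrite /pushforward /=; exact: XY.
  - by move=> _; rewrite /= /pushforward preimage_setT probability_setT ltry.
have ge0 (f : rectType -> \bar R) : measurable_fun setT f -> (forall x, 0 <= f x)%E ->
  (\int[P]_w f (X ^~ w) = \int[P]_w f (Y ^~ w))%E.
  move=> mf f0.
  have := @ge0_integral_pushforward _ _ _ _ R X' mX' P setT f measurableT mf (fun x _ => f0 x).
  have := @ge0_integral_pushforward _ _ _ _ R Y' mY' P setT f measurableT mf (fun x _ => f0 x).
  rewrite !preimage_setT /= => <- <-.
  by apply: eq_measure_integral => A mA _; exact: mu_eq.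
have hp := ge0 (F^\+)%E (measurable_funepos mF) (fun x => funepos_ge0 F x).
have hn := ge0 (F^\-)%E (measurable_funeneg mF) (fun x => funeneg_ge0 F x).
rewrite [LHS]integralE [RHS]integralE; congr (_ - _)%E.
  transitivity (\int[P]_w (F^\+ (X ^~ w)))%E; first by apply: eq_integral => w _; rewrite !funeposE.
  by rewrite hp; apply: eq_integral => w _; rewrite !funeposE.
transitivity (\int[P]_w (F^\- (X ^~ w)))%E; first by apply: eq_integral => w _; rewrite !funenegE.
by rewrite hn; apply: eq_integral => w _; rewrite !funenegE.
Qed.

Lemma stationary_integral (d : nat) (eps : Zd d -> Omega -> R) (idx : I -> Zd d) (k : Zd d)
    (F : rectType -> \bar R) :
  (forall i, measurable_fun setT (eps i)) -> strictly_stationary P eps ->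
  measurable_fun setT F ->
  (\int[P]_w F (fun i => eps (idx i) w) = \int[P]_w F (fun i => eps (zdadd (idx i) k) w))%E.
Proof.
move=> me st mF.
apply: (@integral_law (fun i => eps (idx i)) (fun i => eps (zdadd (idx i) k))) => // B mB.
have := st k #|I| (idx \o enum_val) (B \o enum_val) (fun m => mB _).
have E (Y : I -> Omega -> R) : [set w | forall m : 'I_#|I|, (B \o enum_val) m (Y (enum_val m) w)] =
    [set w | forall i, B i (Y i w)].
  apply/seteqP; split=> w /= H i; last exact: H.
  by have := H (enum_rank i); rewrite enum_rankK.
by have := E (fun i => eps (idx i)) => /= ->; have := E (fun i => eps (zdadd (idx i) k)) => /= ->.
Qed.

End stationary_law.

(** * Lexicographic order *)

Section lexicographic_order.
Context {d : nat}.
Implicit Types i j k : Zd d.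

Lemma lex_lt_trans : forall i j k, lex_lt i j -> lex_lt j k -> lex_lt i k.
Proof.
move=> i j k [p [ijp pq]] [r [jkr rq]].
case: (ltngtP p r) => pr.
- exists p; split; first by rewrite -(rq _ pr).
  by move=> q qp; rewrite pq// rq// (ltn_trans qp pr).
- exists r; split; first by rewrite (pq _ pr).
  by move=> q qr; rewrite pq ?rq// (ltn_trans qr pr).
- have {}pr : p = r by exact: val_inj.
  subst r; exists p; split; first exact: lt_trans ijp jkr.
  by move=> q qp; rewrite pq// rq.
Qed.

Lemma lex_lt_total i j : i != j -> lex_lt i j \/ lex_lt j i.
Proof.
move=> ij.
have [l lP] : exists l, i l != j l.
  by apply/existsP; apply: contraNT ij; rewrite negb_exists => /forallP H;
     apply/eqP/ffunP => l; apply/eqP; have := H l; rewrite negbK.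
case: (@arg_minnP _ l (fun l => i l != j l) (fun l => l) lP) => p pP pmin.
have eq (q : 'I_d) : (q < p)%N -> i q = j q.
  move=> qp; apply/eqP; apply: contraTT qp => nq.
  by rewrite -leqNgt; exact: pmin.
case: (ltgtP (i p) (j p)) => H; [left|right|by rewrite H eqxx in pP].
  by exists p.
by exists p; split=> // q qp; rewrite eq.
Qed.

(** Splitting off the last site puts all others in its lexicographic past, the only region about
    which (C3) speaks. *)
Lemma lex_max (I : finType) (iota : I -> Zd d) (A : {set I}) : injective iota ->
  A != finset.set0 ->
  exists2 i : I, i \in A & forall j : I, j \in A -> j != i -> lex_lt (iota j) (iota i).
Proof.
move=> inj; have [n] := ubnP #|A|; elim: n A => // n IH A cA A0.
have [x xA] := set0Pn _ A0.
have [e|ne] := eqVneq (A :\ x)%SET finset.set0.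
  exists x => // j jA jx; have : j \in (A :\ x)%SET by rewrite !inE jx.
  by rewrite e inE.
have [|i] := IH (A :\ x)%SET _ ne.
  by rewrite (cardsD1 x) xA in cA; lia.
rewrite !inE => /andP[ix iA] im.
have nxi : iota x != iota i by apply: contra ix => /eqP/inj ->.
have [xi|xi] := lex_lt_total nxi.
  exists i => // j jA ji; have [->//|jx] := eqVneq j x.
  by apply: im => //; rewrite !inE jx.
exists x => // j jA jx; have [->//|ji] := eqVneq j i.
by apply: lex_lt_trans xi; apply: im => //; rewrite !inE jx.
Qed.

Definition zdopp i : Zd d := [ffun l => - i l].

Lemma lex_lt_shift i j : lex_lt j i -> lex_lt (zdadd j (zdopp i)) (zd0 d).
Proof.
move=> [p [jip pq]]; exists p; split; first by rewrite !ffunE subr_lt0.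
by move=> q qp; rewrite !ffunE pq// subrr.
Qed.

Lemma zdadd_oppr i : zdadd i (zdopp i) = zd0 d.
Proof. by apply/ffunP => l; rewrite !ffunE subrr. Qed.

Lemma zdist_shift i j : zdist (zd0 d) (zdadd j (zdopp i)) = zdist i j.
Proof.
by apply: eq_bigr => l _; rewrite !ffunE sub0r opprB.
Qed.

Lemma zdist_gt0 i j : i != j -> (0 < zdist i j)%N.
Proof.
move=> ij; rewrite lt0n; apply: contra ij => /eqP z.
apply/eqP/ffunP => l; apply/eqP; rewrite -subr_eq0 -absz_eq0 -leqn0 -z.
exact: (leq_bigmax (F := fun l => `|i l - j l|%N)).
Qed.

Lemma lex_lt_irr i : ~ lex_lt i i.
Proof. by move=> [p [+ _]]; rewrite ltxx. Qed.

Lemma zdadd_inj k : injective (fun i => zdadd i k).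
Proof.
move=> i j /ffunP H; apply/ffunP => l; have := H l; rewrite !ffunE.
exact: addIr.
Qed.

End lexicographic_order.

(** * Moments *)

Section Lp_spaces.
Context {R : realType} {dO : measure_display} {Omega : measurableType dO}.
Context (P : probability Omega R).
Implicit Types X Y U : Omega -> R.
Implicit Types p r : R.

Definition itg X := P.-integrable setT (EFin \o X).

Definition Lp p X := measurable_fun setT X /\ itg (fun w => `|X w| `^ p).

Definition mom p X : R := \int[P]_w (`|X w| `^ p).

Lemma itg_meas X : itg X -> measurable_fun setT X.
Proof. by case/integrableP => /measurable_EFinP. Qed.

Lemma itg_le X Y : measurable_fun setT X -> (forall w, `|X w| <= `|Y w|) -> itg Y -> itg X.
Proof.
move=> mX XY; apply: le_integrable => //; first exact/measurable_EFinP.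
by move=> w _; rewrite /= lee_fin.
Qed.

Lemma itgD X Y : itg X -> itg Y -> itg (fun w => X w + Y w).
Proof. by move=> iX iY; exact: (@integrableD _ _ _ P setT measurableT (EFin \o X) (EFin \o Y)). Qed.

Lemma itgB X Y : itg X -> itg Y -> itg (fun w => X w - Y w).
Proof. by move=> iX iY; exact: (@integrableB _ _ _ P setT measurableT (EFin \o X) (EFin \o Y)). Qed.

Lemma itgZ k X : itg X -> itg (fun w => k * X w).
Proof. by move=> iX; exact: (@integrableZl _ _ _ P setT measurableT k (EFin \o X)). Qed.

Lemma itg_cst k : itg (fun=> k).
Proof. exact: finite_measure_integrable_cst. Qed.

Lemma itg_norm X : itg X -> itg (fun w => `|X w|).
Proof.
move=> iX; apply: itg_le (iX) => [|w]; last by rewrite normr_id.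
by apply: measurableT_comp => //; exact: itg_meas iX.
Qed.

Lemma itg_sum (I : Type) (s : seq I) (F : I -> Omega -> R) :
  (forall i, itg (F i)) -> itg (fun w => \sum_(i <- s) F i w).
Proof.
move=> iF; have := @integrable_sum _ _ _ P setT measurableT I s xpredT (fun i w => (F i w)%:E).
move=> /(_ (fun i _ => iF i)).
by congr (P.-integrable _ _); apply/funext => w; rewrite /= sumEFin.
Qed.

Lemma Rint_sum (I : Type) (s : seq I) (F : I -> Omega -> R) :
  (forall i, itg (F i)) -> \int[P]_w (\sum_(i <- s) F i w) = \sum_(i <- s) \int[P]_w F i w.
Proof.
move=> iF; elim: s => [|i s IH].
  under eq_Rintegral do rewrite big_nil.
  by rewrite big_nil Rintegral_cst// mul0r.
under eq_Rintegral do rewrite big_cons.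
by rewrite big_cons RintegralD ?IH//; [exact: iF|exact: itg_sum].
Qed.

Lemma le_Rint X Y : itg X -> itg Y -> (forall w, X w <= Y w) ->
  \int[P]_w X w <= \int[P]_w Y w.
Proof. by move=> iX iY XY; apply: le_Rintegral. Qed.

Lemma itg_fineK X : itg X -> ((\int[P]_w X w)%:E = \int[P]_w (X w)%:E)%E.
Proof. by move=> iX; rewrite /Rintegral fineK//; exact: integrable_fin_num. Qed.

Lemma mom_ge0 p X : 0 <= mom p X.
Proof. by apply: Rintegral_ge0 => w _; rewrite powR_ge0. Qed.

Lemma meas_norm_powR p X : measurable_fun setT X -> measurable_fun setT (fun w => `|X w| `^ p).
Proof.
move=> mX; apply: (measurableT_comp (measurable_powR p)).
exact: measurableT_comp.
Qed.

Lemma Lp_le p X Y : 0 <= p -> measurable_fun setT X -> (forall w, `|X w| <= `|Y w|) ->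
  Lp p Y -> Lp p X.
Proof.
move=> p0 mX XY [mY iY]; split=> //.
apply: itg_le iY => [|w]; first exact: meas_norm_powR.
by rewrite !(ger0_norm (powR_ge0 _ _)) ge0_ler_powR// nnegrE.
Qed.

Lemma LpD p X Y : 1 <= p -> Lp p X -> Lp p Y -> Lp p (fun w => X w + Y w).
Proof.
move=> p1 [mX iX] [mY iY]; have mXY : measurable_fun setT (fun w => X w + Y w) by exact: measurable_funD.
split=> //; apply: (@itg_le _ (fun w => 2 `^ p * (`|X w| `^ p + `|Y w| `^ p))).
- exact: meas_norm_powR.
- move=> w; rewrite (ger0_norm (powR_ge0 _ _)) [leRHS]ger0_norm ?mulr_ge0 ?addr_ge0 ?powR_ge0//.
  apply: (@le_trans _ _ ((`|X w| + `|Y w|) `^ p)).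
    by rewrite ge0_ler_powR ?nnegrE ?ler_normD// ?addr_ge0//; lra.
  have := powRD_le p1 (@ltr01 R) (@ltr01 R) (normr_ge0 (X w)) (normr_ge0 (Y w)).
  move=> /le_trans; apply; rewrite !divr1.
  have -> : 1 + 1 = 2 :> R by ring.
  rewrite ler_wpM2l ?powR_ge0//.
  by have := powR_ge0 `|X w| p; have := powR_ge0 `|Y w| p; lra.
- by apply: itgZ; exact: itgD.
Qed.

Lemma LpZ p k X : 0 <= p -> Lp p X -> Lp p (fun w => k * X w).
Proof.
move=> p0 [mX iX]; split; first exact: measurable_funM.
have -> : (fun w => `|k * X w| `^ p) = (fun w => `|k| `^ p * `|X w| `^ p).
  by apply/funext => w; rewrite normrM powRM.
exact: itgZ.
Qed.

Lemma Lp0 p : 0 < p -> Lp p (fun=> 0).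
Proof.
move=> p0; split=> //.
by under eq_fun do rewrite normr0 powR0 ?gt_eqF//; exact: itg_cst.
Qed.

Lemma Lp_sum p (I : Type) (s : seq I) (F : I -> Omega -> R) : 1 <= p ->
  (forall i, Lp p (F i)) -> Lp p (fun w => \sum_(i <- s) F i w).
Proof.
move=> p1 LF; elim: s => [|i s IH].
  by under eq_fun do rewrite big_nil; apply: Lp0; lra.
by under eq_fun do rewrite big_cons; exact: LpD.
Qed.

Lemma Lp_itg p X : 1 <= p -> Lp p X -> itg X.
Proof.
move=> p1 [mX iX]; apply: (@itg_le _ (fun w => 1 + `|X w| `^ p)) => //.
  move=> w; rewrite [leRHS]ger0_norm ?addr_ge0 ?powR_ge0//.
  have [x1|x1] := leP `|X w| 1; first by have := powR_ge0 `|X w| p; lra.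
  have : `|X w| <= `|X w| `^ p by rewrite le1r_powR// ltW.
  lra.
by apply: itgD => //; exact: itg_cst.
Qed.

Lemma powR_sqr p x : (x ^+ 2) `^ (p / 2) = `|x| `^ p.
Proof.
rewrite -real_normK ?num_real// -powR_mulrn// -powRrM.
by congr (_ `^ _); field.
Qed.

Lemma Lp_sqr p X : Lp p X -> Lp (p / 2) (fun w => X w ^+ 2).
Proof.
move=> [mX iX]; split; first exact: measurable_funX.
by under eq_fun do rewrite ger0_norm ?sqr_ge0// powR_sqr.
Qed.

Lemma mom_sqr p X : mom (p / 2) (fun w => X w ^+ 2) = mom p X.
Proof. by apply: eq_Rintegral => w _; rewrite ger0_norm ?sqr_ge0// powR_sqr. Qed.

Lemma holder_itg p U Y : 2 < p -> Lp (p / 2) U -> Lp p Y ->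
  itg (fun w => `|U w| * `|Y w| `^ (p - 2)).
Proof.
move=> p2 [mU iU] [mY iY].
apply: (@itg_le _ (fun w => (p / 2)^-1 * `|U w| `^ (p / 2) + (p / (p - 2))^-1 * `|Y w| `^ p)).
- apply: measurable_funM; first exact: measurableT_comp.
  exact: meas_norm_powR.
- have q0 : 0 < p / 2 by lra.
  have q1 : 0 < p / (p - 2) by rewrite divr_gt0//; lra.
  move=> w; have := @conjugate_powR R `|U w| (`|Y w| `^ (p - 2)) (p / 2) (p / (p - 2))
    (normr_ge0 _) (powR_ge0 _ _) q0 q1.
  have -> : (p / 2)^-1 + (p / (p - 2))^-1 = 1 by field; lra.
  move=> /(_ erefl); rewrite -powRrM.
  have -> : (p - 2) * (p / (p - 2)) = p by field; lra.
  move=> H; have N0 : 0 <= `|U w| * `|Y w| `^ (p - 2) by rewrite mulr_ge0 ?powR_ge0.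
  rewrite (ger0_norm N0); apply: le_trans H _.
  by rewrite mulrC [X in _ + X]mulrC ler_norm.
- by apply: itgD; exact: itgZ.
Qed.

(** The conjugate exponents are [p / 2] and [p / (p - 2)]. A common upper bound [m] in place of the
    moment of [Y] lets all partial sums share the same factor. *)
Lemma holder_mom p U Y m : 2 < p -> Lp (p / 2) U -> Lp p Y -> mom p Y <= m ->
  \int[P]_w (`|U w| * `|Y w| `^ (p - 2)) <= (mom (p / 2) U) `^ (2 / p) * m `^ ((p - 2) / p).
Proof.
move=> p2 LU LY mY.
apply: (@le_trans _ _ ((mom (p / 2) U) `^ (2 / p) * (mom p Y) `^ ((p - 2) / p))); last first.
  rewrite ler_wpM2l ?powR_ge0// ge0_ler_powR ?nnegrE ?mom_ge0//.
    by rewrite divr_ge0//; lra.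
  exact: le_trans (mom_ge0 _ _) mY.
have i := holder_itg p2 LU LY.
case: LU LY => [mU iU] [mY' iY].
have q0 : 0 < p / 2 by lra.
have q1 : 0 < p / (p - 2) by rewrite divr_gt0//; lra.
have := @hoelder _ _ _ P U (fun w => `|Y w| `^ (p - 2)) _ _ mU (meas_norm_powR (p - 2) mY') q0 q1.
have -> : (p / 2)^-1 + (p / (p - 2))^-1 = 1 by field; lra.
move=> /(_ erefl); rewrite Lnorm1 unlock /=.
have -> : (\int[P]_x `|(U x * `|Y x| `^ (p - 2))%:E| = (\int[P]_w (`|U w| * `|Y w| `^ (p - 2)))%:E)%E.
  rewrite itg_fineK//; apply: eq_integral => w _.
  by rewrite /= normrM [X in _ * X]ger0_norm ?powR_ge0.
have -> : (\int[P]_x `|(U x)%:E| `^ (p / 2) = (mom (p / 2) U)%:E)%E.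
  by rewrite /mom itg_fineK//; apply: eq_integral.
have -> : (\int[P]_x `|(`|Y x| `^ (p - 2))%:E| `^ (p / (p - 2)) = (mom p Y)%:E)%E.
  rewrite /mom itg_fineK//; apply: eq_integral => w _ /=.
  rewrite ger0_norm ?powR_ge0// -powRrM.
  by have -> : (p - 2) * (p / (p - 2)) = p by field; lra.
by rewrite !poweR_EFin -EFinM lee_fin !invf_div.
Qed.

Lemma Lnorm_Lp r X : 0 < r -> measurable_fun setT X -> (Lnorm P r%:E (EFin \o X) < +oo)%E ->
  Lp r X /\ Lnorm P r%:E (EFin \o X) = ((mom r X) `^ r^-1)%:E.
Proof.
move=> r0 mX; rewrite unlock /= => fin.
have fin' : (\int[P]_x `|(X x)%:E| `^ r < +oo)%E.
  by apply: (@lty_poweRy _ _ r^-1) => //; rewrite invr_eq0 gt_eqF.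
have i : itg (fun w => `|X w| `^ r).
  apply/integrableP; split; first by apply/measurable_EFinP; exact: meas_norm_powR.
  apply: le_lt_trans fin'; rewrite le_eqVlt; apply/orP; left; apply/eqP.
  by apply: eq_integral => w _ /=; rewrite ger0_norm ?powR_ge0.
split=> //; rewrite -poweR_EFin; congr (_ `^ _)%E.
by rewrite /mom itg_fineK//; apply: eq_integral.
Qed.

End Lp_spaces.

(** * Moment inequality for weighted sums *)

Lemma ler_add_twice {R : realType} (x y z : R) : x <= z -> y <= z -> x + y <= 2 * z.
Proof. by move=> xz yz; lra. Qed.

Section moment_inequality.
Context {R : realType} {dO : measure_display} {Omega : measurableType dO}.
Context (P : probability Omega R) {d : nat} (eps : Zd d -> Omega -> R) (p : R).
Context (p2 : 2 < p) (me : forall i, measurable_fun setT (eps i)).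
Context (st : strictly_stationary P eps).

Local Notation zd0 := (zd0 d).

Lemma sigma_field_gen_measurable (Gamma : set (Zd d)) :
  [set A | exists j, Gamma j /\ exists B : set R, measurable B /\ A = eps j @^-1` B] `<=`
  @measurable _ Omega.
Proof.
by move=> _ [j [_ [B [mB ->]]]]; rewrite -[_ @^-1` _]setTI; exact: me.
Qed.

Lemma cond_exp_measurable (Gamma : set (Zd d)) X Z :
  is_cond_exp P (sigma_field eps Gamma) X Z -> measurable_fun setT Z.
Proof.
move=> [mZ _ _] _ B mB; rewrite setTI.
exact: (sub_sigma_measurable (sigma_field_gen_measurable (Gamma := Gamma))) (mZ B mB).
Qed.

(* The weak dependence hypothesis with the esum replaced by its finite partial sums. *)
Definition C3_bound (Z : nat -> Omega -> R) (kappa : R) :=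
  [/\ Lp P p (eps zd0),
      forall m, (1 <= m)%N -> is_cond_exp P (sigma_field eps (Vset zd0 m)) (eps zd0) (Z m),
      forall k, Vset zd0 1 k -> Lp P (p / 2) (fun w => eps k w * Z (zdist zd0 k) w) &
      forall s : seq (Zd d), uniq s -> (forall k, k \in s -> Vset zd0 1 k) ->
        \sum_(k <- s) mom P (p / 2) (fun w => eps k w * Z (zdist zd0 k) w) `^ (2 / p) <= kappa].

Lemma cond_C3_bound : cond_C3 P eps p -> exists Z kappa, C3_bound Z kappa.
Proof.
move=> [Lfin [Z [ce fin]]].
have hp := p2; have p0 : 0 < p by lra.
have q0 : 0 < p / 2 by lra.
pose a k := Lnorm P (p / 2)%:E (fun w => (eps k w * Z (zdist zd0 k) w)%:E).
have a0 k : (0 <= a k)%E by exact: Lnorm_ge0.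
have aE k : Vset zd0 1 k -> Lp P (p / 2) (fun w => eps k w * Z (zdist zd0 k) w) /\
    a k = (mom P (p / 2) (fun w => eps k w * Z (zdist zd0 k) w) `^ (2 / p))%:E.
  move=> Vk; have [] := @Lnorm_Lp _ _ _ P (p / 2) (fun w => eps k w * Z (zdist zd0 k) w) q0.
  - apply: measurable_funM => //; apply: cond_exp_measurable (ce _ _).
    by case: Vk.
  (* A single term is at most the whole [esum], hence finite. *)
  - apply: le_lt_trans fin; rewrite -[leLHS](@esum_set1 _ _ k a)//.
    rewrite [leRHS](_ : _ = \esum_(k in Vset zd0 1) a k)//.
    rewrite esum_mkcond [leRHS]esum_mkcond; apply: le_esum => j _.
    case: ifPn => [|_]; last by case: ifP.
    by rewrite inE /= => ->; rewrite mem_set.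
  - by move=> ? ?; rewrite -[2 / p]invf_div.
exists Z, (fine (\esum_(k in Vset zd0 1) a k)); split => //.
- by have [] := Lnorm_Lp p0 (me zd0) Lfin.
- by move=> k /aE[].
move=> s us sV; rewrite -lee_fin fineK; last first.
  by rewrite ge0_fin_numE//; apply: esum_ge0 => k _.
apply: (@le_trans _ _ (\sum_(k <- s) a k)%E).
  rewrite -sumEFin [leLHS]big_seq [leRHS]big_seq; apply: lee_sum => k ks.
  by have [_ ->] := aE _ (sV _ ks).
apply: esum_ge; exists [set` s]; first by split=> //= k /sV.
by rewrite fsbig_seq.
Qed.

Section weighted_sums.
Context (I : finType) (iota : I -> Zd d) (c : I -> R) (cm : R).
Context (iota_inj : injective iota) (c_le : forall i, `|c i| <= cm).

(** The shift [k] is carried along because (C3) is stated at the origin: stationarity translates the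
    whole sum until the site under study sits there. *)
Definition wsum (k : Zd d) (A : {set I}) (w : Omega) : R :=
  \sum_(j in A) c j * eps (zdadd (iota j) k) w.

Definition coord_sum (A : {set I}) (x : I -> R) : R := \sum_(j in A) c j * x j.

Lemma measurable_coord_sum A : measurable_fun setT (coord_sum A : @rectType R I -> R).
Proof.
rewrite /coord_sum.
have -> : (fun x : @rectType R I => \sum_(j in A) c j * x j) =
    (fun x => \sum_(j <- enum A) c j * x j).
  by apply/funext => x; rewrite big_enum.
by apply: measurable_sum => j; apply: measurable_funM => //; exact: measurable_coord.
Qed.

Lemma measurable_psi : measurable_fun setT (psi p : R -> R).
Proof. by apply: measurable_funM => //; exact: meas_norm_powR. Qed.

Lemma zdadd0 i : zdadd i zd0 = i.
Proof. by apply/ffunP => l; rewrite !ffunE addr0. Qed.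

Lemma stationary_Rint (k : Zd d) (F : @rectType R I -> R) : measurable_fun setT F ->
  \int[P]_w F (fun i => eps (zdadd (iota i) k) w) = \int[P]_w F (fun i => eps (zdadd (iota i) zd0) w).
Proof.
move=> mF; rewrite /Rintegral; congr fine.
have mF' : measurable_fun setT (EFin \o F) by exact/measurable_EFinP.
have e1 := stationary_integral iota k me st mF'.
have e2 := stationary_integral iota zd0 me st mF'.
by rewrite -[LHS]e1 -[RHS]e2.
Qed.

Lemma Lp_eps i : Lp P p (eps zd0) -> Lp P p (eps i).
Proof.
move=> [_ i0]; split=> //.
have mF : measurable_fun setT (fun x : @rectType R 'I_1 => `|(x ord0)| `^ p).
  by apply: meas_norm_powR; exact: measurable_coord.
have E (k : Zd d) := stationary_integral (fun _ : 'I_1 => zd0) k me st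
   (proj2 (measurable_EFinP _ _) mF).
apply/integrableP; split; first by apply/measurable_EFinP; exact: meas_norm_powR.
move/integrableP: i0 => [_]; apply: le_lt_trans; rewrite le_eqVlt; apply/orP; left; apply/eqP.
have := E i; have -> : zdadd zd0 i = i by apply/ffunP => l; rewrite !ffunE add0r.
move=> H; transitivity (\int[P]_w (`|eps i w| `^ p)%:E)%E.
  by apply: eq_integral => w _ /=; rewrite ger0_norm ?powR_ge0.
etransitivity; first exact: esym H.
by apply: eq_integral => w _ /=; rewrite (ger0_norm (powR_ge0 _ _)).
Qed.

Context (Z : nat -> Omega -> R) (kappa : R) (C3 : C3_bound Z kappa).

Lemma Lp_wsum k A : Lp P p (wsum k A).
Proof.
have hp := p2; have [L0 _ _ _] := C3.
rewrite /wsum; under eq_fun do rewrite -big_enum.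
apply: Lp_sum => [|j]; first by lra.
by apply: LpZ; [lra|exact: Lp_eps].
Qed.

Lemma mom_wsum k A : mom P p (wsum k A) = mom P p (wsum zd0 A).
Proof.
apply: (stationary_Rint k (F := fun x => `|coord_sum A x| `^ p)).
by apply: meas_norm_powR; exact: measurable_coord_sum.
Qed.

Local Notation S := (wsum zd0).

Definition nrm (k : Zd d) : R := mom P (p / 2) (fun w => eps k w * Z (zdist zd0 k) w) `^ (2 / p).

Lemma psi_wsum_le k A B w :
  `|psi p (wsum k A w) - psi p (wsum k B w)| <=
  (p - 1) * (`|wsum k A w - wsum k B w| * (`|wsum k B w| `^ (p - 2) + `|wsum k A w| `^ (p - 2))).
Proof. exact: psi_lip. Qed.

Lemma itg_eps_psi k i A : itg P (fun w => eps i w * psi p (wsum k A w)).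
Proof.
have hp := p2; have [L0 _ _ _] := C3.
have LX := Lp_eps i L0; have LS := Lp_wsum k A.
have mS : measurable_fun setT (wsum k A) by case: LS.
(* One factor of the sum is moved over to [eps], which brings the product into the shape required by
   [holder_itg]. *)
have L2 : Lp P (p / 2) (fun w => `|eps i w| * `|wsum k A w|).
  apply: (@Lp_le _ _ _ P (p / 2) _ (fun w => eps i w ^+ 2 + wsum k A w ^+ 2)); first by lra.
  - by apply: measurable_funM; exact: measurableT_comp.
  - move=> w; rewrite [leRHS]ger0_norm ?addr_ge0 ?sqr_ge0// normrM !normr_id.
    rewrite -(real_normK (num_real (eps i w))) -(real_normK (num_real (wsum k A w))).
    have := normr_ge0 (eps i w); have := normr_ge0 (wsum k A w).
    move: `|eps i w| `|wsum k A w| => u v v0 u0; nra.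
  - apply: LpD; [lra|exact: Lp_sqr|exact: Lp_sqr].
apply: itg_le (holder_itg p2 L2 LS).
  by apply: measurable_funM => //; exact: measurableT_comp measurable_psi mS.
move=> w; rewrite /psi !normrM !normr_id mulrA.
by rewrite le_eqVlt; apply/orP; left.
Qed.

Lemma sigma_field_wsum k (A : {set I}) (Gamma : set (Zd d)) (B : set R) :
  (forall j, j \in A -> Gamma (zdadd (iota j) k)) -> measurable B ->
  sigma_field eps Gamma (wsum k A @^-1` B).
Proof.
move=> AG mB.
set C := [set A | exists j, Gamma j /\ exists B : set R, measurable B /\ A = eps j @^-1` B].
suff H : @measurable_fun _ _ (g_sigma_algebraType C : measurableType _) _ setT (wsum k A).
  by have := H measurableT B mB; rewrite setTI.
rewrite /wsum; under eq_fun do rewrite big_mkcond.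
apply: (@measurable_sum _ (g_sigma_algebraType C : measurableType _)) => j.
case: (boolP (j \in A)) => jA; last exact: measurable_cst.
apply: measurable_funM; first exact: measurable_cst.
move=> _ D mD; rewrite setTI; apply: sub_sigma_algebra.
by exists (zdadd (iota j) k); split; [exact: AG|exists D].
Qed.

Lemma wsum_remove k (B : {set I}) i w : i \in B ->
  wsum k B w - wsum k (B :\ i)%SET w = c i * eps (zdadd (iota i) k) w.
Proof. by move=> iB; rewrite /wsum (big_setD1 i)//= addrK. Qed.

(* After a shift by [- iota i] the increment of [psi] is measurable with respect to the sites at
   distance at least [zdist (iota i) (iota k)], because [k] is a nearest site of [B]; so [eps 0]
   may be replaced there by its conditional expectation. *)
Lemma psi_step (i k : I) (B : {set I}) (m : R) :
  k \in B -> (forall j, j \in B -> lex_lt (iota j) (iota i)) ->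
  (forall j, j \in B -> (zdist (iota i) (iota k) <= zdist (iota i) (iota j))%N) ->
  (forall A : {set I}, A \subset B -> mom P p (S A) <= m) ->
  `|\int[P]_w (eps (iota i) w * (psi p (S B w) - psi p (S (B :\ k)%SET w)))| <=
  2 * (p - 1) * cm * nrm (zdadd (iota k) (zdopp (iota i))) * m `^ ((p - 2) / p).
Proof.
move=> kB Blt kmin mS; have hp := p2; have p1 : 0 <= p - 1 by lra.
have [L0 ce LZ _] := C3.
set si := zdopp (iota i); set B' := (B :\ k)%SET; set kt := zdadd (iota k) si.
have ik : iota i != iota k.
  by apply/eqP => e; have := Blt _ kB; rewrite e; exact: lex_lt_irr.
set r := zdist (iota i) (iota k); have r1 : (1 <= r)%N by exact: zdist_gt0.
have rE : zdist zd0 kt = r by exact: zdist_shift.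
have VB j : j \in B -> Vset zd0 r (zdadd (iota j) si).
  move=> jB; split; first by apply: lex_lt_shift; exact: Blt.
  by rewrite zdist_shift; exact: kmin.
have Vk1 : Vset zd0 1 kt by have [? ?] := VB _ kB; split=> //; rewrite rE.
pose f w := psi p (wsum si B w) - psi p (wsum si B' w).
have -> : \int[P]_w (eps (iota i) w * (psi p (S B w) - psi p (S B' w))) =
    \int[P]_w (f w * eps zd0 w).
  have mF : measurable_fun setT (fun x : @rectType R I =>
      x i * (psi p (coord_sum B x) - psi p (coord_sum B' x))).
    apply: measurable_funM; first exact: measurable_coord.
    by apply: measurable_funB; apply: measurableT_comp measurable_psi _; exact: measurable_coord_sum.
  transitivity (\int[P]_w (eps (zdadd (iota i) zd0) w * (psi p (S B w) - psi p (S B' w)))).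
    by rewrite zdadd0.
  etransitivity; first (symmetry; exact: (stationary_Rint si mF)).
  by apply: eq_Rintegral => w _; rewrite zdadd_oppr mulrC.
have mf : measurable_fun setT f.
  by apply: measurable_funB; apply: measurableT_comp measurable_psi _; exact: (Lp_wsum _ _).1.
have itgf X : itg P (fun w => X w * psi p (wsum si B w)) ->
   itg P (fun w => X w * psi p (wsum si B' w)) -> itg P (fun w => f w * X w).
  move=> i1 i2; have := itgB i1 i2; congr (itg P _).
  by apply/funext => w; rewrite /f; ring.
have ifX : itg P (fun w => f w * eps zd0 w) by apply: itgf; exact: itg_eps_psi.
pose U w := eps kt w * Z r w.
have LU : Lp P (p / 2) U by have := LZ _ Vk1; rewrite rE.
have LB := Lp_wsum si B; have LB' := Lp_wsum si B'.
(* The increment of the sum carries the factor [eps kt]; multiplied by the conditional expectation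
   [Z r] it becomes [U], the product whose norm (C3) sums. *)
have bnd w : `|f w * Z r w| <=
   (p - 1) * cm * (`|U w| * `|wsum si B' w| `^ (p - 2) + `|U w| * `|wsum si B w| `^ (p - 2)).
  rewrite normrM /f.
  apply: le_trans (ler_wpM2r (normr_ge0 _) (psi_wsum_le _ _ _ _)) _.
  rewrite (wsum_remove _ _ kB) normrM /U normrM -/kt.
  set x := `|eps kt w|; set y := `|Z r w|.
  set A1 := `|wsum si B' w| `^ _; set A2 := `|wsum si B w| `^ _.
  rewrite [leRHS](_ : _ = (p - 1) * (cm * x * (A1 + A2)) * y); last by ring.
  have x0 : 0 <= x by exact: normr_ge0.
  have y0 : 0 <= y by exact: normr_ge0.
  rewrite (ler_wpM2r y0)// ler_wpM2l//.
  by rewrite ler_wpM2r ?addr_ge0 ?powR_ge0// (ler_wpM2r x0).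
have i1 := holder_itg p2 LU LB; have i2 := holder_itg p2 LU LB'.
have ibnd : itg P (fun w => (p - 1) * cm *
    (`|U w| * `|wsum si B' w| `^ (p - 2) + `|U w| * `|wsum si B w| `^ (p - 2))).
  by apply: itgZ; exact: itgD.
have mZ : measurable_fun setT (Z r) := cond_exp_measurable (ce _ r1).
have ifZ : itg P (fun w => f w * Z r w).
  apply: itg_le ibnd; first exact: measurable_funM.
  by move=> w; apply: le_trans (bnd w) _; exact: ler_norm.
have fG D : measurable D -> sigma_field eps (Vset zd0 r) (f @^-1` D).
  move=> mD.
  set C := [set A | exists j, Vset zd0 r j /\ exists B : set R, measurable B /\ A = eps j @^-1` B].
  suff H : @measurable_fun _ _ (g_sigma_algebraType C : measurableType _) _ setT f.
    by have := H measurableT D mD; rewrite setTI.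
  have mW (A : {set I}) : A \subset B ->
      @measurable_fun _ _ (g_sigma_algebraType C : measurableType _) _ setT (wsum si A).
    move=> /fintype.subsetP AB _ E mE; rewrite setTI; apply: sigma_field_wsum => // j /AB.
    exact: VB.
  apply: measurable_funB; apply: (measurableT_comp measurable_psi); apply: mW => //.
  exact: subsetDl.
have e0 := Lp_itg (ltW (lt_trans (@ltr1n R 2) p2)) L0.
have := cond_exp_pull_out (sigma_field_gen_measurable (Gamma := Vset zd0 r)) (ce _ r1) e0 fG ifX ifZ.
move=> eq; have -> : \int[P]_w (f w * eps zd0 w) = \int[P]_w (f w * Z r w).
  by rewrite /Rintegral eq.
apply: le_trans (le_normr_Rintegral measurableT ifZ) _.
apply: le_trans (le_Rint (itg_norm ifZ) ibnd bnd) _.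
rewrite RintegralZl//; last exact: itgD.
rewrite RintegralD//.
have mB' (A : {set I}) : A \subset B -> mom P p (wsum si A) <= m.
  by move=> AB; rewrite mom_wsum; exact: mS.
have h1 := holder_mom p2 LU LB (mB' _ (subxx _)).
have h2 := holder_mom p2 LU LB' (mB' _ (subsetDl _ _)).
have cm0 : 0 <= cm by exact: le_trans (normr_ge0 _) (c_le i).
have -> : nrm kt = mom P (p / 2) U `^ (2 / p) by rewrite /nrm rE.
apply: (@le_trans _ _ ((p - 1) * cm * (2 * (mom P (p / 2) U `^ (2 / p) * m `^ ((p - 2) / p))))).
  by apply: ler_wpM2l; [exact: mulr_ge0 | exact: ler_add_twice h2 h1].
rewrite le_eqVlt; apply/orP; left; apply/eqP.
by move: (mom _ _ _ `^ _) (m `^ _) => x y; ring.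
Qed.

(** The telescoping ends at the empty sum, where [psi p 0 = 0], so the whole term consists of
    increments bounded by [psi_step]. *)
Lemma eps_psi_le (i : I) (m : R) (B : {set I}) :
  (forall j, j \in B -> lex_lt (iota j) (iota i)) ->
  (forall A : {set I}, A \subset B -> mom P p (S A) <= m) ->
  `|\int[P]_w (eps (iota i) w * psi p (S B w))| <=
  2 * (p - 1) * cm * (\sum_(k in B) nrm (zdadd (iota k) (zdopp (iota i)))) * m `^ ((p - 2) / p).
Proof.
have [n] := ubnP #|B|; elim: n B => // n IH B cB Blt mS.
have [->|B0] := eqVneq B finset.set0.
  rewrite big_set0 mulr0 mul0r (_ : \int[P]_w _ = 0) ?normr0//.
  transitivity (\int[P]_(w in [set: Omega]) (0 : R)); last by rewrite Rintegral_cst// mul0r.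
  by apply: eq_Rintegral => w _; rewrite /wsum big_set0 /psi mul0r mulr0.
have [x xB] := set0Pn _ B0.
case: (arg_minnP (fun k => zdist (iota i) (iota k)) xB) => k kB kmin.
have {}kB : k \in B := kB.
set B' := (B :\ k)%SET.
have B'B : B' \subset B by exact: subsetDl.
have step := psi_step kB Blt kmin mS.
rewrite (cardsD1 k) kB in cB.
have H := IH B' cB (fun j jB => Blt j (fintype.subsetP B'B j jB))
  (fun A AB => mS A (fintype.subset_trans AB B'B)).
have i1 := itg_eps_psi zd0 (iota i) B'; have i2 := itg_eps_psi zd0 (iota i) B.
have -> : \int[P]_w (eps (iota i) w * psi p (S B w)) =
    \int[P]_w (eps (iota i) w * psi p (S B' w)) +
    \int[P]_w (eps (iota i) w * (psi p (S B w) - psi p (S B' w))).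
  rewrite -RintegralD//; first by apply: eq_Rintegral => w _; ring.
  have := itgB i2 i1; congr (P.-integrable _ _).
  by apply/funext => w; rewrite /= mulrBr.
apply: le_trans (ler_normD _ _) _.
rewrite (big_setD1 k)//= mulrDr mulrDl addrC; exact: lerD.
Qed.

(** The differences [iota k - iota i] are distinct points of the past of the origin, so this is a
    finite partial sum of (C3), bounded independently of [i] and [B]. *)
Lemma sum_nrm_le (i : I) (B : {set I}) : (forall j, j \in B -> lex_lt (iota j) (iota i)) ->
  \sum_(k in B) nrm (zdadd (iota k) (zdopp (iota i))) <= kappa.
Proof.
move=> Blt; have [_ _ _ K] := C3.
rewrite -big_enum -(big_map (fun k => zdadd (iota k) (zdopp (iota i))) xpredT nrm) /=.
apply: K.
  by rewrite map_inj_uniq ?enum_uniq// => j k /zdadd_inj/iota_inj.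
move=> k /mapP[j]; rewrite mem_enum => jB ->; split; first by apply: lex_lt_shift; exact: Blt.
rewrite zdist_shift; apply: zdist_gt0.
by apply/eqP => e; have := Blt _ jB; rewrite e; exact: lex_lt_irr.
Qed.

(* [moment_cst] collects the cross terms ([kappa]) and the squares of the Taylor step [powR_taylor]. *)
Definition moment_cst : R := 2 * p * (p - 1) * (kappa + mom P p (eps zd0) `^ (2 / p)).

Lemma moment_step_identity (q K y x z M : R) :
  2 * q * (q - 1) * (K + y) * x ^+ 2 * (1 + z) * M =
  2 * q * (q - 1) * (K + y) * x ^+ 2 * z * M +
  (q * (2 * (q - 1) * x ^+ 2 * K * M) + q * (q - 1) * x ^+ 2 * (2 * (y * M))).
Proof. by ring. Qed.

Lemma kappa_ge0 : 0 <= kappa.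
Proof. by have [_ _ _ K] := C3; have := K [::] isT; rewrite big_nil; apply. Qed.

Lemma moment_cst_ge0 : 0 <= moment_cst.
Proof.
have hp := p2; rewrite /moment_cst mulr_ge0 ?addr_ge0 ?powR_ge0 ?kappa_ge0//.
by rewrite !mulr_ge0//; lra.
Qed.

Lemma mom_eps i : mom P p (eps i) = mom P p (eps zd0).
Proof.
rewrite /mom /Rintegral; congr fine.
have mF : measurable_fun setT (fun x : @rectType R 'I_1 => `|(x ord0)| `^ p).
  by apply: meas_norm_powR; exact: measurable_coord.
have := stationary_integral (fun _ : 'I_1 => zd0) i me st (proj2 (measurable_EFinP _ _) mF).
have -> : zdadd zd0 i = i by apply/ffunP => l; rewrite !ffunE add0r.
by move=> H; exact: esym H.
Qed.

(** Each new site costs at most the same amount in [powR_taylor], whence linear growth in the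
    cardinality. The bound [m] must cover every subset because the telescoping of the linear term
    passes through many of them. *)
Lemma mom_wsum_rec (m : R) (A : {set I}) :
  (forall B : {set I}, B \subset A -> mom P p (S B) <= m) ->
  mom P p (S A) <= moment_cst * cm ^+ 2 * #|A|%:R * m `^ ((p - 2) / p).
Proof.
have hp := p2; have pge0 : 0 <= p by lra.
have p1ge0 : 0 <= p - 1 by lra.
have [n] := ubnP #|A|; elim: n A => // n IH A cA mS.
have [L0 _ _ _] := C3.
have [->|A0] := eqVneq A finset.set0.
  rewrite cards0 mulr0 mul0r /mom (_ : \int[P]_w _ = 0)//.
  transitivity (\int[P]_(w in [set: Omega]) (0 : R)); last by rewrite Rintegral_cst// mul0r.
  by apply: eq_Rintegral => w _; rewrite /wsum big_set0 normr0 powR0// gt_eqF//; lra.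
have [i iA imax] := lex_max iota_inj A0.
set A' := (A :\ i)%SET; have A'A : A' \subset A by exact: subsetDl.
rewrite (cardsD1 i) iA in cA *.
have {}IH := IH A' cA (fun B BA => mS B (fintype.subset_trans BA A'A)).
have A'lt j : j \in A' -> lex_lt (iota j) (iota i).
  by rewrite !inE => /andP[ji jA]; exact: imax.
have cross := eps_psi_le A'lt (fun B BA => mS B (fintype.subset_trans BA A'A)).
have sumle := sum_nrm_le A'lt.
set M := m `^ ((p - 2) / p) in IH cross *.
have M0 : 0 <= M by exact: powR_ge0.
have cm0 : 0 <= cm by exact: le_trans (normr_ge0 _) (c_le i).
set e := eps (iota i).
have Le : Lp P p e by exact: Lp_eps.
have LA := Lp_wsum zd0 A; have LA' := Lp_wsum zd0 A'.
have Le2 := Lp_sqr Le.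
have j1 := holder_itg p2 Le2 LA; have j2 := holder_itg p2 Le2 LA'.
have h1 := holder_mom p2 Le2 LA (mS _ (subxx _)).
have h2 := holder_mom p2 Le2 LA' (mS _ A'A).
have ipsi := itg_eps_psi zd0 (iota i) A'.
pose T w := p * c i * (e w * psi p (S A' w)).
pose Q w := p * (p - 1) * cm ^+ 2 *
   (`|e w ^+ 2| * `|S A' w| `^ (p - 2) + `|e w ^+ 2| * `|S A w| `^ (p - 2)).
have iT : itg P T by exact: itgZ.
have iQ : itg P Q by apply: itgZ; exact: itgD.
have ptw w : `|S A w| `^ p <= `|S A' w| `^ p + (T w + Q w).
  have := powR_taylor (S A' w) (S A w) p2.
  rewrite (wsum_remove _ _ iA) zdadd0 -/e => tay.
  have : p * ((p - 1) * ((c i * e w) ^+ 2 * (`|S A' w| `^ (p - 2) + `|S A w| `^ (p - 2)))) <= Q w.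
    rewrite /Q (ger0_norm (sqr_ge0 _)) -mulrDr exprMn.
    rewrite [leRHS](_ : _ = p * ((p - 1) * (cm ^+ 2 * e w ^+ 2 * (`|S A' w| `^ (p - 2) + `|S A w| `^ (p - 2))))); last by ring.
    rewrite ler_wpM2l// ler_wpM2l//.
    rewrite ler_wpM2r ?addr_ge0 ?powR_ge0// ler_wpM2r ?sqr_ge0//.
    by rewrite -(real_normK (num_real (c i))) lerXn2r// nnegrE.
  move=> tay2; move: (le_trans tay tay2); rewrite /T.
  have -> : p * (psi p (S A' w) * (c i * e w)) = p * c i * (e w * psi p (S A' w)) by ring.
  by rewrite -lerBlDl -lerBlDl.
have step1 : mom P p (S A) <= mom P p (S A') + (\int[P]_w T w + \int[P]_w Q w).
  have iTQ := itgD iT iQ.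
  rewrite -(RintegralD measurableT iT iQ) -(RintegralD measurableT LA'.2 iTQ).
  apply: le_Rint ptw; first exact: LA.2.
  exact: itgD LA'.2 iTQ.
have hT : \int[P]_w T w <= p * (2 * (p - 1) * cm ^+ 2 * kappa * M).
  rewrite RintegralZl//; apply: le_trans (ler_norm _) _.
  rewrite normrM normrM (ger0_norm pge0).
  rewrite -mulrA ler_wpM2l//.
  apply: le_trans (ler_pM (normr_ge0 _) (normr_ge0 _) (c_le i) cross) _.
  rewrite [leLHS](_ : _ = (2 * (p - 1) * cm ^+ 2 * M) *
     \sum_(k in A') nrm (zdadd (iota k) (zdopp (iota i)))); last by ring.
  rewrite [leRHS](_ : _ = (2 * (p - 1) * cm ^+ 2 * M) * kappa); last by ring.
  by rewrite ler_wpM2l// mulr_ge0// mulr_ge0 ?sqr_ge0// mulr_ge0.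
have hQ : \int[P]_w Q w <= p * (p - 1) * cm ^+ 2 * (2 * (mom P p (eps zd0) `^ (2 / p) * M)).
  rewrite RintegralZl//; last exact: itgD.
  have q0 : 0 <= p * (p - 1) by rewrite mulr_ge0.
  rewrite ler_wpM2l//; first by rewrite mulr_ge0 ?sqr_ge0.
  rewrite RintegralD//.
  by rewrite mom_sqr mom_eps -/M in h1 h2; exact: ler_add_twice h2 h1.
have E : moment_cst * cm ^+ 2 * (true + #|A'|)%:R * M = moment_cst * cm ^+ 2 * #|A'|%:R * M +
   (p * (2 * (p - 1) * cm ^+ 2 * kappa * M) +
    p * (p - 1) * cm ^+ 2 * (2 * (mom P p (eps zd0) `^ (2 / p) * M))).
  by rewrite natrD /moment_cst; exact: moment_step_identity.
by rewrite E; apply: le_trans step1 _; apply: lerD => //; exact: lerD.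
Qed.

(** With [m] the largest moment over subsets of [Q], a maximum over a finite family, the recursion
    reads [m <= C * m ^ (1 - 2 / p)]; dividing gives [m ^ (2 / p) <= C]. *)
Lemma moment_sum (Q : {set I}) :
  mom P p (fun w => \sum_(j in Q) c j * eps (iota j) w) <=
  (moment_cst * cm ^+ 2 * #|Q|%:R) `^ (p / 2).
Proof.
have hp := p2.
have -> : (fun w => \sum_(j in Q) c j * eps (iota j) w) = S Q.
  by apply/funext => w; apply: eq_bigr => j _; rewrite zdadd0.
pose m := \big[Num.max/0]_(A in powerset Q) mom P p (S A).
have mle (A : {set I}) : A \subset Q -> mom P p (S A) <= m.
  by move=> AQ; rewrite /m (bigD1 A) ?powersetE//= le_max lexx.
have m0 : 0 <= m by apply: le_trans (mom_ge0 P p _) (mle _ (subxx Q)).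
have K0 := moment_cst_ge0.
have mub : m <= moment_cst * cm ^+ 2 * #|Q|%:R * m `^ ((p - 2) / p).
  have rhs0 : 0 <= moment_cst * cm ^+ 2 * #|Q|%:R * m `^ ((p - 2) / p).
    by rewrite mulr_ge0 ?powR_ge0// mulr_ge0 ?ler0n// mulr_ge0 ?sqr_ge0.
  rewrite {1}/m; elim/big_rec: _ => // A x; rewrite powersetE => AQ xle.
  rewrite ge_max xle andbT.
  apply: le_trans (mom_wsum_rec (fun B BA => mle B (fintype.subset_trans BA AQ))) _.
  rewrite ler_wpM2r ?powR_ge0// ler_wpM2l//; first by rewrite mulr_ge0 ?sqr_ge0.
  by rewrite ler_nat subset_leq_card.
apply: le_trans (mle _ (subxx Q)) _.
have [m_eq0|m_neq0] := eqVneq m 0; first by rewrite m_eq0 powR_ge0.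
have {m_neq0}mpos : 0 < m by rewrite lt_neqAle eq_sym m_neq0.
have : m `^ (2 / p) <= moment_cst * cm ^+ 2 * #|Q|%:R.
  rewrite -(@ler_pM2r _ (m `^ ((p - 2) / p))); last exact: powR_gt0.
  rewrite -powRD; last by rewrite (gt_eqF mpos) implybT.
  have e1 : 2 / p + (p - 2) / p = 1 by field; lra.
  by rewrite e1 powRr1.
move=> H.
have -> : m = (m `^ (2 / p)) `^ (p / 2).
  by rewrite -powRrM (_ : 2 / p * (p / 2) = 1) ?powRr1//; field; lra.
rewrite ge0_ler_powR ?nnegrE ?powR_ge0//; first by lra.
by rewrite mulr_ge0// mulr_ge0 ?sqr_ge0.
Qed.

End weighted_sums.
End moment_inequality.

(** * Maximal inequality *)

Section prefix_maxima.
Context {R : realType} {dO : measure_display} {Omega : measurableType dO}.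
Context (P : probability Omega R) (p : R) (p2 : 2 < p).

(** Minkowski's inequality without norms: taking [a] and [b] as weights in [powRD_le] makes the two
    contributions add up to exactly [(a + b) ^ p]. *)
Lemma mom_add_le (X Y : Omega -> R) (a b : R) : 0 < a -> 0 < b ->
  Lp P p X -> Lp P p Y -> (forall w, 0 <= X w) -> (forall w, 0 <= Y w) ->
  mom P p X <= a `^ p -> mom P p Y <= b `^ p ->
  mom P p (fun w => X w + Y w) <= (a + b) `^ p.
Proof.
move=> a0 b0 LX LY X0 Y0 mX mY; have hp := p2; have p1 : 1 <= p by lra.
have ab : 0 < a + b by rewrite addr_gt0.
pose cX := (a + b) `^ p * (a / (a + b)) * (a^-1) `^ p.
pose cY := (a + b) `^ p * (b / (a + b)) * (b^-1) `^ p.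
have cX0 : 0 <= cX by rewrite mulr_ge0 ?powR_ge0// mulr_ge0 ?powR_ge0// divr_ge0// ltW.
have cY0 : 0 <= cY by rewrite mulr_ge0 ?powR_ge0// mulr_ge0 ?powR_ge0// divr_ge0// ltW.
have iX := itgZ cX LX.2; have iY := itgZ cY LY.2.
have pt w : `|X w + Y w| `^ p <= cX * `|X w| `^ p + cY * `|Y w| `^ p.
  rewrite !ger0_norm ?addr_ge0//.
  apply: le_trans (powRD_le p1 a0 b0 (X0 w) (Y0 w)) _.
  have ia : 0 <= a^-1 by rewrite invr_ge0 ltW.
  have ib : 0 <= b^-1 by rewrite invr_ge0 ltW.
  rewrite (powRM _ (X0 w) ia) (powRM _ (Y0 w) ib) /cX /cY.
  by rewrite le_eqVlt; apply/orP; left; apply/eqP; ring.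
apply: (@le_trans _ _ (\int[P]_w (cX * `|X w| `^ p + cY * `|Y w| `^ p))).
  by apply: le_Rint pt; [exact: (LpD p1 LX LY).2|exact: itgD].
have -> : \int[P]_w (cX * `|X w| `^ p + cY * `|Y w| `^ p) = cX * mom P p X + cY * mom P p Y.
  by rewrite RintegralD// !RintegralZl//; [exact: LY.2|exact: LX.2].
have bd x (c m : R) : 0 < x -> 0 <= c -> m <= x `^ p -> c * (x^-1) `^ p * m <= c.
  move=> x0 c0 mx; rewrite -mulrA ler_piMr//.
  apply: (@le_trans _ _ ((x^-1) `^ p * x `^ p)); first by rewrite ler_wpM2l ?powR_ge0.
  by rewrite -powRM ?invr_ge0 ?(ltW x0)// mulVf ?gt_eqF// powR1.
have -> : (a + b) `^ p = (a + b) `^ p * (a / (a + b)) + (a + b) `^ p * (b / (a + b)).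
  by field; rewrite gt_eqF.
by apply: lerD; apply: bd => //; rewrite mulr_ge0 ?powR_ge0// divr_ge0// ltW.
Qed.

Lemma mom_max_le (X Y : Omega -> R) : Lp P p X -> Lp P p Y ->
  (forall w, 0 <= X w) -> (forall w, 0 <= Y w) ->
  Lp P p (fun w => Num.max (X w) (Y w)) /\
  mom P p (fun w => Num.max (X w) (Y w)) <= mom P p X + mom P p Y.
Proof.
move=> LX LY X0 Y0; have hp := p2; have p0 : 0 <= p by lra.
have p1 : 1 <= p by lra.
have mM : measurable_fun setT (fun w => Num.max (X w) (Y w)).
  by apply: measurable_maxr; [exact: LX.1|exact: LY.1].
have LM : Lp P p (fun w => Num.max (X w) (Y w)).
  apply: Lp_le (LpD p1 LX LY) => // w; rewrite !ger0_norm ?addr_ge0 ?le_max ?X0//.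
  by rewrite ge_max; have := X0 w; have := Y0 w; lra.
split=> //; have := LX.2; have := LY.2; rewrite /mom => iY iX.
rewrite -(RintegralD measurableT iX iY); apply: le_Rint; [exact: LM.2|exact: itgD|].
move=> w; rewrite /Num.max; case: ifP => _; first by rewrite lerDr powR_ge0.
by rewrite lerDl powR_ge0.
Qed.

Context {d n : nat}.
Local Notation I := {ffun 'I_d -> 'I_n}.
Context (X : I -> Omega -> R) (B : R) (B0 : 0 < B).

Definition setsum (Q : {set I}) (w : Omega) : R := \sum_(j in Q) X j w.

Context (LS : forall Q, Lp P p (setsum Q)).
Context (mS : forall Q, mom P p (setsum Q) <= (B * #|Q|%:R) `^ (p / 2)).

(** Positions beyond the grid are cut off by the type of the indices, so dyadic blocks may overshoot
    it; the product of the lengths then only bounds the cardinality from above. *)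
Definition pbox (s len : 'I_d -> nat) : {set I} :=
  [set i : I | [forall l, (s l <= i l)%N && (i l < s l + len l)%N]]%SET.

Lemma card_pbox (s len : 'I_d -> nat) : (#|pbox s len| <= \prod_(l < d) len l)%N.
Proof.
pose F (l : 'I_d) := [pred k : 'I_n | (s l <= k)%N && (k < s l + len l)%N].
have -> : #|pbox s len| = #|family F|.
  by apply: eq_card => i; rewrite inE; apply/forallP/familyP.
rewrite card_family.
rewrite foldrE big_image /=; apply: leq_prod => l _.
rewrite /F cardE size_filter.
have -> : count [pred k : 'I_n | (s l <= k)%N && (k < s l + len l)%N] (Finite.enum 'I_n) =
    count (fun k => (s l <= k)%N && (k < s l + len l)%N) (iota 0 n).
  by rewrite -enumT -val_enum_ord count_map.
rewrite -size_filter -[leqRHS](size_iota (s l)).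
apply: uniq_leq_size; first by rewrite filter_uniq// iota_uniq.
by move=> k; rewrite mem_filter !mem_iota => /andP[].
Qed.

Definition upd (f : 'I_d -> nat) (k : 'I_d) (v : nat) (l : 'I_d) := if l == k then v else f l.

Lemma pbox_split (s u : 'I_d -> nat) (k : 'I_d) (a v : nat) w : u k = (a + v)%N ->
  setsum (pbox s u) w = setsum (pbox s (upd u k a)) w + setsum (pbox (upd s k (s k + a)) (upd u k v)) w.
Proof.
move=> uk; rewrite /setsum -bigU /=; last first.
  rewrite disjoint_subset; apply/fintype.subsetP => i; rewrite !inE => /forallP/(_ k).
  rewrite /upd eqxx => /andP[_ H]; apply/negP => /forallP/(_ k); rewrite !eqxx; lia.
apply: eq_bigl => i; rewrite !inE; apply/forallP/orP.
  move=> H; have [ik|ik] := ltnP (i k) (s k + a).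
    left; apply/forallP => l; have := H l; rewrite /upd; case: eqP => // ->; lia.
  right; apply/forallP => l; have := H l; rewrite /upd; case: eqP => // ->; lia.
by case=> /forallP H l; have := H l; rewrite /upd; case: eqP => // ->; lia.
Qed.

(* Solves [1 + 2 ^ (1 / p) * x = 2 ^ (1 / 2) * x], the recursion for doubling one side. *)
Definition doubling_cst : R := (2 `^ (1 / 2) - 2 `^ (1 / p))^-1.

(** The place where [2 < p] makes doubling work: taking the maximum over two halves costs
    [2 ^ (1 / p)], while the bound grows by [2 ^ (1 / 2)]. The upper bound makes [doubling_cst] at
    least 1, so [side] does not decrease in [k]. *)
Lemma doubling_gap : 0 < (2 : R) `^ (1 / 2) - 2 `^ (1 / p) <= 1.
Proof.
have hp := p2.
have lt : (1 / p : R) < 1 / 2 by rewrite ltr_pM2l// ltf_pV2 ?posrE; lra.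
apply/andP; split.
  rewrite subr_gt0 /powR; have -> : ((2 : R) == 0) = false by apply/eqP; lra.
  by rewrite ltr_expR ltr_pM2r// ln_gt0; lra.
have h1 : (2 : R) `^ (1 / 2) <= 2.
  by rewrite -[leRHS](@powRr1 _ 2)// ler_powR//; lra.
have h2 : 1 <= (2 : R) `^ (1 / p).
  rewrite -[leLHS](@powRr0 _ 2) ler_powR//; first by lra.
  by rewrite divr_ge0//; lra.
lra.
Qed.

Lemma doubling_cst_ge1 : 1 <= doubling_cst.
Proof.
have /andP[a b] := doubling_gap.
by rewrite /doubling_cst invf_ge1.
Qed.

(* [side k (vol q) ^ p] bounds the p-th moment of the maximum over prefixes in the first [k]
   directions of a block of volume [2 ^ vol q]. *)
Definition side (k N : nat) : R := doubling_cst ^+ k * (B * 2 ^+ N) `^ (1 / 2).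

Lemma side_gt0 k N : 0 < side k N.
Proof.
have D1 := doubling_cst_ge1.
rewrite mulr_gt0// ?exprn_gt0 ?powR_gt0 ?mulr_gt0 ?exprn_gt0//.
exact: lt_le_trans D1.
Qed.

Lemma side_double k N : side k N + 2 `^ (1 / p) * side k.+1 N = side k.+1 N.+1.
Proof.
have /andP[a _] := doubling_gap.
rewrite /side [(2 : R) ^+ N.+1]exprS (exprS doubling_cst).
rewrite (_ : B * (2 * 2 ^+ N) = 2 * (B * 2 ^+ N)); last by ring.
rewrite (@powRM _ 2 (B * 2 ^+ N))//; last by rewrite mulr_ge0 ?exprn_ge0// ltW.
have : doubling_cst * (2 `^ (1 / 2) - 2 `^ (1 / p)) = 1 by rewrite mulVf ?gt_eqF.
move: ((B * 2 ^+ N) `^ (1 / 2)) => z; move: doubling_cst (2 `^ (1 / 2)) (2 `^ (1 / p)) => D x y H.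
rewrite (_ : _ + _ = (1 + y * D) * (D ^+ k * z)); last by ring.
by rewrite -H; ring.
Qed.

Lemma side_leS k N : side k N <= side k.+1 N.
Proof.
have D1 := doubling_cst_ge1.
rewrite /side exprS -mulrA ler_peMl// mulr_ge0 ?powR_ge0// exprn_ge0//; lra.
Qed.

Definition vol (q : 'I_d -> nat) := (\sum_l q l)%N.

(** Lengths are free in the directions below [k] and full in the others. A dominating function
    replaces the maximum itself and can be assembled from those of smaller blocks. *)
Definition prefix_dominating (k : nat) (s q : 'I_d -> nat) (G : Omega -> R) : Prop :=
  [/\ Lp P p G, (forall w, 0 <= G w),
    (forall u, (forall l, (u l <= 2 ^ q l)%N) -> (forall l : 'I_d, (k <= l)%N -> u l = (2 ^ q l)%N) ->
       forall w, `|setsum (pbox s u) w| <= G w) &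
    mom P p G <= side k (vol q) `^ p].

Lemma setsum0 s u (l : 'I_d) w : u l = 0%N -> setsum (pbox s u) w = 0.
Proof.
move=> ul; rewrite /setsum big1// => i; rewrite inE => /forallP/(_ l).
by rewrite ul; lia.
Qed.

Lemma prefix_max0 s q : exists G, prefix_dominating 0 s q G.
Proof.
have hp := p2; pose Q := pbox s (fun l => 2 ^ q l)%N.
exists (fun w => `|setsum Q w|); split => //.
- apply: Lp_le (LS Q) => //; first by lra.
    by apply: measurableT_comp => //; exact: (LS Q).1.
  by move=> w; rewrite normr_id.
- move=> u _ uq w; rewrite (_ : pbox s u = Q)//.
  by apply/setP => i; rewrite !inE; apply: eq_forallb => l; rewrite uq.
- rewrite (_ : mom P p _ = mom P p (setsum Q)); last first.
    by apply: eq_Rintegral => w _; rewrite normr_id.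
  apply: le_trans (mS Q) _; rewrite /side expr0 mul1r -powRrM.
  rewrite (_ : 1 / 2 * p = p / 2); last by ring.
  rewrite ge0_ler_powR ?nnegrE//; first by lra.
  + by rewrite mulr_ge0// ltW.
  + by rewrite mulr_ge0// ?exprn_ge0// ltW.
  rewrite ler_wpM2l ?(ltW B0)// -natrX ler_nat.
  by apply: leq_trans (card_pbox _ _) _; rewrite /vol expn_sum.
Qed.

Lemma volD (q : 'I_d -> nat) (k : 'I_d) r : q k = r.+1 -> vol q = (vol (upd q k r)).+1.
Proof.
move=> qk; rewrite /vol (bigD1 k)//= [in RHS](bigD1 k)//= qk /upd eqxx addSn.
by congr ((_ + _).+1)%N; apply: eq_bigr => l /negPf ->.
Qed.

(** Induction on the dyadic size of side [k]. A prefix either stays in the left half, or consists of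
    the full left half, already handled at stage [k], and a prefix of the right half. *)
Lemma prefix_maxS (k : 'I_d) :
  (forall s q, exists G, prefix_dominating k s q G) ->
  forall r s q, q k = r -> exists G, prefix_dominating k.+1 s q G.
Proof.
move=> IHk; have hp := p2.
have p0 : 0 <= p by lra.
have p1 : 1 <= p by lra.
have pV : 1 / p * p = 1 by field; lra.
elim=> [|r IHr] s q qk.
  have [G [LG G0 domG mG]] := IHk s q; exists G; split => //.
    (* The side has length 1, so a prefix is empty or full in direction [k]. *)
    move=> u uq uk w; have [uk0|uk0] := eqVneq (u k) 0%N.
      by rewrite (setsum0 _ _ uk0) normr0.
    apply: domG => // l; rewrite leq_eqVlt => /predU1P[kl|]; last exact: uk.
    have -> : l = k by exact: val_inj.
    by have := uq k; rewrite qk expn0; lia.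
  apply: le_trans mG _.
  by rewrite ge0_ler_powR ?nnegrE ?side_leS// ltW// side_gt0.
pose q' := upd q k r; pose s' := upd s k (s k + 2 ^ r).
have q'k : q' k = r by rewrite /q' /upd eqxx.
have [N [LN N0 domN mN]] := IHk s q'.
have [GL [LL L0 domL mL]] := IHr s q' q'k.
have [GR [LR R0 domR mR]] := IHr s' q' q'k.
have [LM mM] := mom_max_le LL LR L0 R0.
have M0 w : 0 <= Num.max (GL w) (GR w) by rewrite le_max L0.
(* [N] serves the full left half, and the maximum serves a prefix of either half. The moment of the
   maximum is at most twice that of one half, the source of [2 ^ (1 / p)] in [side_double]. *)
exists (fun w => N w + Num.max (GL w) (GR w)); split.
- exact: LpD.
- by move=> w; rewrite addr_ge0.
- move=> u uq uk w.
  have upd_le (v : nat) : (v <= 2 ^ r)%N -> forall l, (upd u k v l <= 2 ^ q' l)%N.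
    by move=> vr l; rewrite /q' /upd; case: eqP.
  have upd_full (v : nat) (l : 'I_d) : (k < l)%N -> upd u k v l = (2 ^ q' l)%N.
    by move=> kl; rewrite /q' /upd; case: eqP => [e|_]; [rewrite e ltnn in kl|exact: uk].
  have [ukr|ukr] := leqP (u k) (2 ^ r).
    have -> : pbox s u = pbox s (upd u k (u k)).
      by apply/setP => i; rewrite !inE; apply: eq_forallb => l; rewrite /upd; case: eqP => // ->.
    apply: le_trans (domL _ (upd_le _ ukr) (upd_full _) w) _.
    by rewrite -[leLHS]add0r lerD// le_max lexx.
  have uE : u k = (2 ^ r + (u k - 2 ^ r))%N by rewrite subnKC// ltnW.
  rewrite (pbox_split _ _ uE); apply: le_trans (ler_normD _ _) _; apply: lerD.
    apply: domN; first exact: upd_le.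
    move=> l; rewrite leq_eqVlt => /predU1P[kl|]; last exact: upd_full.
    have -> : l = k by exact: val_inj.
    by rewrite /q' /upd eqxx.
  rewrite -/s' le_max; apply/orP; right; apply: domR; last exact: upd_full.
  by apply: upd_le; have := uq k; rewrite qk expnS; lia.
- rewrite (volD qk) -side_double; apply: mom_add_le => //; first exact: side_gt0.
    by rewrite mulr_gt0 ?side_gt0// powR_gt0.
  apply: le_trans mM _; rewrite powRM ?powR_ge0// ?(ltW (side_gt0 _ _))//.
  by rewrite -powRrM pV powRr1//; exact: ler_add_twice mL mR.
Qed.

Lemma prefix_max s q : exists G, prefix_dominating d s q G.
Proof.
suff H k : (k <= d)%N -> forall s q, exists G, prefix_dominating k s q G by exact: H.
elim: k => [|k IH] kd s1 q1; first exact: prefix_max0.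
exact: (@prefix_maxS (Ordinal kd) (IH (ltnW kd)) _ s1 q1 erefl).
Qed.

(** In each direction an interval is the difference of two prefixes, so every direction doubles the
    number of prefix boxes. *)
Lemma setsum_box_le s q G : prefix_dominating d s q G ->
  forall a v : 'I_d -> nat, (forall l, (a l + v l <= 2 ^ q l)%N) ->
  forall w, `|setsum (pbox (fun l => s l + a l)%N v) w| <= 2 ^+ d * G w.
Proof.
move=> [_ G0 domG _] a0 v0 av0 w.
suff H k : (k <= d)%N -> forall a v : 'I_d -> nat, (forall l, (a l + v l <= 2 ^ q l)%N) ->
    (forall l : 'I_d, (k <= l)%N -> a l = 0%N) ->
    `|setsum (pbox (fun l => s l + a l)%N v) w| <= 2 ^+ k * G w.
  by apply: (H d) => // l; have := ltn_ord l; lia.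
elim: k => [|k IH] kd a v av ak.
  have -> : pbox (fun l => s l + a l)%N v = pbox s v.
    by apply/setP => i; rewrite !inE; apply: eq_forallb => l; rewrite ak// addn0.
  rewrite expr0 mul1r; apply: domG => [l|l]; last by have := ltn_ord l; lia.
  by have := av l; lia.
pose k' := Ordinal kd; pose a' := upd a k' 0; pose v' := upd v k' (a k' + v k').
have v'k : v' k' = (a k' + v k')%N by rewrite /v' /upd eqxx.
have a'0 (l : 'I_d) : (k <= l)%N -> a' l = 0%N.
  rewrite /a' /upd; case: eqP => // /eqP lk kl; apply: ak.
  by rewrite ltn_neqAle kl andbT; apply: contra lk => /eqP kl'; apply/eqP/val_inj.
have := pbox_split (fun l => s l + a' l)%N w v'k.
have -> : pbox (upd (fun l => s l + a' l)%N k' (s k' + a' k' + a k')) (upd v' k' (v k')) =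
    pbox (fun l => s l + a l)%N v.
  by apply/setP => i; rewrite !inE; apply: eq_forallb => l; rewrite /a' /v' /upd;
     case: eqP => // ->; rewrite eqxx addn0.
move=> E; have -> : setsum (pbox (fun l => s l + a l)%N v) w =
    setsum (pbox (fun l => s l + a' l)%N v') w - setsum (pbox (fun l => s l + a' l)%N (upd v' k' (a k'))) w.
  by rewrite E addrAC subrr add0r.
apply: le_trans (ler_normB _ _) _.
rewrite exprS -mulrA; apply: ler_add_twice.
  apply: (IH (ltnW kd) a' v') => // l.
  by have := av l; rewrite /a' /v' /upd; case: eqP => // ->.
apply: (IH (ltnW kd) a' (upd v' k' (a k'))) => // l.
by have := av l; rewrite /a' /v' /upd; case: eqP => [->|_ //]; lia.
Qed.

End prefix_maxima.

(** * Kernel sums over the grid *)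

Section grid.
Context {R : realType}.

(** The successor reflects the encoding of grid coordinates: index [k] stands for coordinate
    [k + 1]. *)
Lemma first_above (t : R) : exists u : nat, forall k : nat, (t <= k.+1%:R) = (u <= k)%N.
Proof.
have ex : exists k : nat, t <= k.+1%:R.
  exists (Num.truncn t); exact: ltW (truncnS_gt _).
exists (ex_minn ex); case: ex_minnP => u tu um k; apply/idP/idP; first exact: um.
by move=> uk; apply: le_trans tu _; rewrite ler_nat ltnS.
Qed.

Lemma last_below (t : R) : exists w : nat, forall k : nat, (k.+1%:R <= t) = (k < w)%N.
Proof.
have ex : exists k : nat, t < k.+1%:R.
  by exists (Num.truncn t); exact: truncnS_gt.
exists (ex_minn ex); case: ex_minnP => w tw wm k; apply/idP/idP.
  by move=> kt; rewrite ltnNge; apply/negP => wk; have := lt_le_trans tw (le_trans _ kt);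
     rewrite ltxx => H; suff : false by []; apply: H; rewrite ler_nat ltnS.
by move=> kw; rewrite leNgt; apply/negP => /wm; rewrite leqNgt kw.
Qed.

Lemma count_iota_ge (a b n : nat) : (b <= n)%N ->
  (b - a <= count (fun k => (a <= k)%N && (k < b)%N) (iota 0 n))%N.
Proof.
move=> bn; rewrite -size_filter -[leqLHS](size_iota a); apply: uniq_leq_size; first exact: iota_uniq.
by move=> k; rewrite mem_filter !mem_iota; lia.
Qed.

Lemma card_box_ge (d n : nat) (a b : 'I_d -> nat) : (forall l, (b l <= n)%N) ->
  (\prod_(l < d) (b l - a l) <=
   #|[set i : {ffun 'I_d -> 'I_n} | [forall l, (a l <= i l)%N && (i l < b l)%N]]%SET|)%N.
Proof.
move=> bn; pose F (l : 'I_d) := [pred k : 'I_n | (a l <= k)%N && (k < b l)%N].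
rewrite (_ : #|_| = #|family F|); last first.
  by apply: eq_card => i; rewrite inE; apply/forallP/familyP.
rewrite card_family foldrE big_image /=; apply: leq_prod => l _.
rewrite /F cardE size_filter.
rewrite (_ : count _ (Finite.enum 'I_n) =
    count (fun k => (a l <= k)%N && (k < b l)%N) (iota 0 n)); first exact: count_iota_ge.
by rewrite -enumT -val_enum_ord count_map.
Qed.

(** Near an endpoint only half of the kernel window meets the grid, so a one-sided window is used
    throughout: to the right of [x] if [x <= 1 / 2], to the left otherwise. Rounding loses at most
    one point, hence at most half of [n * h >= 2]. *)
Lemma interval_window (x h : R) (n : nat) : 0 <= x <= 1 -> 0 < h <= 1 / 2 -> 2 <= n%:R * h ->
  exists a b : nat, [/\ (b <= n)%N, n%:R * h / 2 <= (b - a)%:R &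
    forall k : nat, (a <= k < b)%N -> `|x - k.+1%:R / n%:R| <= h].
Proof.
move=> /andP[x0 x1] /andP[h0 h1] nh.
have n0 : 0 < n%:R :> R by rewrite -(pmulr_lgt0 _ h0); lra.
have [y [y0 yh yx xy]] : exists y, [/\ 0 <= y, y + h <= 1, y <= x & x <= y + h].
  by have [xh|xh] := leP x (1 / 2); [exists x|exists (x - h)]; split; lra.
set a := Num.truncn (n%:R * y); set b := Num.truncn (n%:R * (y + h)).
have ny0 : 0 <= n%:R * y by rewrite mulr_ge0// ltW.
have nyh0 : 0 <= n%:R * (y + h) by rewrite mulr_ge0 ?addr_ge0// ltW.
have /andP[a1 a2] := truncn_itv ny0; have /andP[b1 b2] := truncn_itv nyh0.
rewrite -/a -/b in a1 a2 b1 b2.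
exists a, b; split.
- rewrite -(ler_nat R); apply: le_trans b1 _.
  by rewrite -[leRHS]mulr1 ler_pM2l.
- have : n%:R * h - 1 <= b%:R - a%:R.
    by move: a1 b2; rewrite mulrDr -(natr1 b) => a1 b2; lra.
  move=> H; have ab : (a <= b)%N by rewrite -(ler_nat R); lra.
  by rewrite natrB//; lra.
- move=> k /andP[ak kb].
  have k1 : n%:R * y <= k.+1%:R by apply: le_trans (ltW a2) _; rewrite ler_nat ltnS.
  have k2 : k.+1%:R <= n%:R * (y + h) by apply: le_trans b1; rewrite ler_nat.
  have e1 : y <= k.+1%:R / n%:R by rewrite ler_pdivlMr// mulrC.
  have e2 : k.+1%:R / n%:R <= y + h by rewrite ler_pdivrMr// mulrC.
  by rewrite ler_norml; apply/andP; split; lra.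
Qed.

Lemma dyadic_cover (t : R) : 1 <= t -> exists r : nat, t <= 2 ^+ r <= 2 * t.
Proof.
move=> t1; have ex : exists r : nat, t <= 2 ^+ r.
  exists (Num.truncn t).+1; apply: le_trans (ltW (truncnS_gt _)) _.
  by rewrite -natrX ler_nat ltnW// ltn_expl.
exists (ex_minn ex); case: ex_minnP => -[|r] tr rm; rewrite tr/=; first by rewrite expr0; lra.
rewrite exprS ler_pM2l// leNgt; apply/negP => /ltW /rm; by rewrite ltnn.
Qed.

End grid.

(** * The kernel: Lipschitz extension, lower bound of the denominator, support boxes *)

Section kernel_sums.
Context {R : realType} {d : nat} (K : ('I_d -> R) -> R).

(** The kernel is Lipschitz on the cube but jumps to 0 outside; composed with [clip] it becomes
    bounded and Lipschitz everywhere, and the jump is left to the index set of the sum. *)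
Definition clip (t : R) : R := Num.max (-1) (Num.min t 1).

Lemma clip_itv t : -1 <= clip t <= 1.
Proof. by rewrite /clip le_max lexx/= ge_max ge_min lexx orbT andbT; lra. Qed.

Lemma clip_id t : -1 <= t <= 1 -> clip t = t.
Proof. by move=> /andP[a b]; rewrite /clip (min_l b) (max_r a). Qed.

Lemma clip_lip s t : `|clip s - clip t| <= `|s - t|.
Proof.
rewrite ler_norml; have := ler_norm (s - t); have := ler_norm (t - s); rewrite (distrC t s).
move: `|s - t| => N H1 H2.
rewrite /clip /Num.max /Num.min; case: (ltP s 1) => ?; case: (ltP t 1) => ?;
 case: (ltP (-1) s) => ?; case: (ltP (-1) t) => ?; case: (ltP (-1) (1 : R)) => ?; apply/andP; split; lra.
Qed.

Context (A1 : assumption_A1 K).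

Lemma kweight_out (n : nat) (h : R) (x : 'I_d -> R) (i : {ffun 'I_d -> 'I_n}) : 0 < h ->
  ~~ [forall l, `|x l - lam_pt i l| <= h] -> kweight K h x i = 0.
Proof.
move=> h0 /forallPn[l nl]; case: A1 => _ _ K0 _ _.
apply: K0 => /(_ l); rewrite -ler_norml normrM normfV (gtr0_norm h0) ler_pdivrMr// mul1r.
exact/negP.
Qed.

Lemma sum_kweight_ge : exists2 c : R, 0 < c & forall (n : nat) (h : R) (x : 'I_d -> R),
  cube 0 1 x -> 0 < h <= 1 / 2 -> 2 <= n%:R * h ->
  c * (n%:R * h) ^+ d <= \sum_(i : {ffun 'I_d -> 'I_n}) kweight K h x i.
Proof.
case: (A1) => K0 _ _ _ [c [C [c0 C0 cC]]].
exists (c * (1 / 2) ^+ d); first by rewrite mulr_gt0// exprn_gt0.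
move=> n h x xc hh nh.
have /choice[ab abP] : forall l : 'I_d, exists ab : nat * nat, [/\ (ab.2 <= n)%N,
    n%:R * h / 2 <= (ab.2 - ab.1)%:R &
    forall k : nat, (ab.1 <= k < ab.2)%N -> `|x l - k.+1%:R / n%:R| <= h].
  by move=> l; have [a [b H]] := interval_window (xc l) hh nh; exists (a, b).
case/andP: hh => h0 _.
pose Q := [set i : {ffun 'I_d -> 'I_n} |
  [forall l, ((ab l).1 <= i l)%N && (i l < (ab l).2)%N]]%SET.
rewrite (bigID (mem Q))/=; apply: ler_wpDr; first by apply: sumr_ge0 => i _; exact: K0.
have Kc i : i \in Q -> c <= kweight K h x i.
  rewrite inE => /forallP iQ.
  suff /cC/andP[] : cube (-1) 1 (fun l => (x l - lam_pt i l) / h) by [].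
  move=> l; have [_ _ /(_ _ (iQ l))] := abP l.
  by rewrite -ler_norml normrM normfV (gtr0_norm h0) ler_pdivrMr// mul1r.
apply: (@le_trans _ _ (\sum_(i in Q) c)); last exact: ler_sum.
rewrite sumr_const -[c *+ _]mulr_natr -mulrA (ler_wpM2l (ltW c0))//.
have bn l : ((ab l).2 <= n)%N by have [] := abP l.
have := card_box_ge (fun l => (ab l).1) bn; rewrite -(ler_nat R); apply: le_trans.
rewrite natr_prod -exprMn -[d in X in X <= _]card_ord -prodr_const.
apply: ler_prod => l _; have [_ H _] := abP l.
by rewrite mulrCA mul1r mulrC in H *; apply/andP; split; [rewrite mulr_ge0//; lra|lra].
Qed.

Lemma kernel_clip_lip : exists eta C : R, [/\ 0 < eta, 0 < C &
  forall a b : 'I_d -> R, `|K (clip \o a)| <= C /\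
    (forall delta, 0 <= delta -> (forall l, `|a l - b l| <= delta) ->
       `|K (clip \o a) - K (clip \o b)| <= eta * delta)].
Proof.
case: (A1) => K0 _ _ [eta [eta0 Klip]] [c [C [c0 C0 cC]]].
have cl (a : 'I_d -> R) : cube (-1) 1 (clip \o a) by move=> l; exact: clip_itv.
exists eta, C; split => // a b; split.
  by rewrite ger0_norm//; have /andP[] := cC _ (cl a).
move=> delta d0 ab; apply: le_trans (Klip _ _ (cl a) (cl b)) _.
rewrite ler_wpM2l ?(ltW eta0)// /supnorm; elim/big_rec: _ => // l z _ zd.
by rewrite ge_max zd andbT; apply: le_trans (clip_lip _ _) (ab l).
Qed.

(** The windows of all [x] within [h] of [y] lie within [2 * h] of [y], so a single dyadic block of
    corner [s], independent of [x], contains them. *)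
Lemma support_box (n : nat) (h : R) (y : 'I_d -> R) (r : nat) : (0 < n)%N -> 0 < h ->
  4 * n%:R * h + 1 <= 2 ^+ r ->
  exists s : 'I_d -> nat, forall x : 'I_d -> R, (forall l, `|x l - y l| <= h) ->
    exists a v : 'I_d -> nat, (forall l, (a l + v l <= 2 ^ r)%N) /\
      forall i : {ffun 'I_d -> 'I_n},
        [forall l, `|x l - lam_pt i l| <= h] = (i \in pbox (fun l => s l + a l)%N v).
Proof.
move=> n0 h0 hr; have n0' : 0 < n%:R :> R by rewrite ltr0n.
have /choice[s sP] : forall l : 'I_d, exists u : nat, forall k : nat,
  (n%:R * (y l - 2 * h) <= k.+1%:R) = (u <= k)%N by move=> l; exact: first_above.
exists s => x xy.
have /choice[av avP] : forall l : 'I_d, exists av : nat * nat, (av.1 + av.2 <= 2 ^ r)%N /\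
   forall k : nat, (`|x l - k.+1%:R / n%:R| <= h) =
     (s l + av.1 <= k)%N && (k < s l + av.1 + av.2)%N.
  move=> l; have := xy l; rewrite ler_norml => /andP[xy1 xy2].
  have [u uP] := first_above (n%:R * (x l - h)).
  have [w wP] := last_below (n%:R * (x l + h)).
  have inE k : (`|x l - k.+1%:R / n%:R| <= h) = (u <= k)%N && (k < w)%N.
    have e1 : (n%:R * (x l - h) <= k.+1%:R) = (x l - h <= k.+1%:R / n%:R).
      by rewrite ler_pdivlMr// mulrC.
    have e2 : (k.+1%:R <= n%:R * (x l + h)) = (k.+1%:R / n%:R <= x l + h).
      by rewrite ler_pdivrMr// mulrC.
    rewrite -uP -wP e1 e2 ler_norml.
    by rewrite andbC; congr andb; apply/idP/idP => ?; lra.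
  have su : (s l <= u)%N.
    rewrite -sP; apply: (@le_trans _ _ (n%:R * (x l - h))); last by rewrite uP.
    by rewrite ler_pM2l//; lra.
  have wr : (w <= s l + 2 ^ r)%N.
    case: w wP {inE} => // w wP.
    have H1 : w.+1%:R <= n%:R * (x l + h) by rewrite wP.
    have H2 : n%:R * (y l - 2 * h) <= (s l).+1%:R by rewrite sP.
    rewrite -(ler_nat R) natrD natrX; apply: le_trans H1 _.
    have : n%:R * (x l + h) <= n%:R * (y l - 2 * h) + 4 * n%:R * h.
      by rewrite (_ : _ + _ = n%:R * (y l + 2 * h)); [rewrite ler_pM2l//; lra|ring].
    by rewrite -natr1 in H2; move: (n%:R * (x l + h)) (n%:R * (y l - _)) H2 => A B ? ?; lra.
  (* The truncations only matter for an empty window, where the length becomes 0 and the position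
     stays inside the block. *)
  exists (minn u (maxn w (s l)) - s l, maxn w (s l) - minn u (maxn w (s l)))%N => /=.
  by split=> [|k]; [lia|rewrite inE; apply/idP/idP; lia].
exists (fst \o av), (snd \o av); split=> [l|i]; first by have [] := avP l.
rewrite !inE; apply: eq_forallb => l; have [_ H] := avP l.
exact: H.
Qed.

End kernel_sums.

(** * Cells *)

Section cell_bound.
Context {R : realType} {dO : measure_display} {Omega : measurableType dO}.
Context (P : probability Omega R) {d : nat} (eps : Zd d -> Omega -> R) (p : R).
Context (p2 : 2 < p) (me : forall i, measurable_fun setT (eps i)).
Context (st : strictly_stationary P eps) (Z : nat -> Omega -> R) (kappa : R).
Context (C3 : C3_bound P eps p Z kappa) (K : ('I_d -> R) -> R) (A1 : assumption_A1 K).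

Lemma lam_idx_inj (n : nat) : injective (@lam_idx d n).
Proof.
move=> i j /ffunP H; apply/ffunP => l; apply/val_inj.
by have := H l; rewrite !ffunE => -[].
Qed.

Definition noise_sum (n : nat) (h : R) (x : 'I_d -> R) (w : Omega) : R :=
  \sum_(i : {ffun 'I_d -> 'I_n}) eps (lam_idx i) w * kweight K h x i.

Definition abs_sum (n : nat) (w : Omega) : R :=
  \sum_(i : {ffun 'I_d -> 'I_n}) `|eps (lam_idx i) w|.

Lemma noise_sum_box (n : nat) (h : R) (x : 'I_d -> R) (Q : {set {ffun 'I_d -> 'I_n}}) w : 0 < h ->
  (forall i, [forall l, `|x l - lam_pt i l| <= h] = (i \in Q)) ->
  noise_sum n h x w = \sum_(i in Q) eps (lam_idx i) w *
     K (clip \o (fun l => (x l - lam_pt i l) / h)).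
Proof.
move=> h0 QE; rewrite /noise_sum (bigID (mem Q)) /= [X in _ + X]big1 ?addr0; last first.
  by move=> i iQ; rewrite (kweight_out A1 h0) ?mulr0// QE.
apply: eq_bigr => i; rewrite -QE => /forallP H; congr (_ * _).
rewrite /kweight; congr K; apply/funext => l; rewrite /= clip_id//.
by rewrite -ler_norml normrM normfV (gtr0_norm h0) ler_pdivrMr// mul1r.
Qed.

Lemma abs_sum_ge0 n w : 0 <= abs_sum n w.
Proof. exact: sumr_ge0. Qed.

Lemma sqrt_powR_pow (x : R) : 0 <= x -> (x ^+ d) `^ (1 / 2) = x `^ (d%:R / 2).
Proof. by move=> x0; rewrite -powR_mulrn// -powRrM mul1r. Qed.

Lemma cell_bound : exists C1 C2 : R, [/\ 0 < C1, 0 < C2 &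
  forall (n : nat) (h : R) (y : 'I_d -> R), (0 < n)%N -> 0 < h -> 1 <= n%:R * h ->
  exists G : Omega -> R, [/\ Lp P p G, (forall w, 0 <= G w),
    mom P p G <= (C1 * (n%:R * h) `^ (d%:R / 2)) `^ p &
    forall (x : 'I_d -> R) (delta : R), delta <= h -> (forall l, `|x l - y l| <= delta) -> 0 <= delta ->
    forall w, `|noise_sum n h x w| <= 2 ^+ d * G w + C2 * (delta / h) * abs_sum n w]].
Proof.
have hp := p2; have [L0 _ _ _] := C3.
have p0 : 0 <= p / 2 by lra.
have p0' : 0 <= p by lra.
have p1 : 1 <= p by lra.
have [eta [C [eta0 C0 KC]]] := kernel_clip_lip A1.
pose Mc := moment_cst P eps p kappa.
have Mc0 : 0 <= Mc by exact: (moment_cst_ge0 p2 C3).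
(* The summand 1 only makes [B] positive, as the doubling argument requires. *)
pose B := Mc * C ^+ 2 + 1.
have MC0 : 0 <= Mc * C ^+ 2 by rewrite mulr_ge0// sqr_ge0.
have B0 : 0 < B by rewrite /B; lra.
have D1 := doubling_cst_ge1 p2.
have D0 : 0 < doubling_cst p by exact: lt_le_trans D1.
(* The block side is at most [2 * (4 * n * h + 1)], which is at most [10 * n * h] since
   [1 <= n * h]. *)
pose C1 := doubling_cst p ^+ d * (B * 10 ^+ d) `^ (1 / 2).
have C10 : 0 < C1 by rewrite mulr_gt0 ?exprn_gt0// powR_gt0// mulr_gt0// exprn_gt0.
exists C1, eta; split => // n h y n0 h0 nh.
(* Coefficients frozen at the centre [y]: the maximal inequality needs summands that do not depend
   on [x]. *)
pose cc (i : {ffun 'I_d -> 'I_n}) := K (clip \o (fun l => (y l - lam_pt i l) / h)).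
pose X i w := cc i * eps (lam_idx i) w.
have ccC i : `|cc i| <= C by have [] := KC (fun l => (y l - lam_pt i l) / h) (fun=> 0).
have LS Q : Lp P p (setsum X Q).
  rewrite /setsum; under eq_fun do rewrite -big_enum.
  apply: Lp_sum => // i; apply: LpZ => //; exact: (Lp_eps me st).
have mS Q : mom P p (setsum X Q) <= (B * #|Q|%:R) `^ (p / 2).
  apply: le_trans (moment_sum p2 me st (@lam_idx_inj n) ccC C3 Q) _.
  rewrite ge0_ler_powR ?nnegrE//.
  - by rewrite mulr_ge0.
  - by rewrite mulr_ge0// ltW.
  - by rewrite ler_wpM2r// /B lerDl.
have t1 : 1 <= 4 * n%:R * h + 1 by rewrite lerDr -mulrA mulr_ge0// ltW// mulr_gt0 ?ltr0n.
have [r /andP[r1 r2]] := dyadic_cover t1.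
have [s sP] := support_box y n0 h0 r1.
have [G GP] := prefix_max p2 B0 LS mS s (fun=> r).
have Gbox := setsum_box_le p2 B0 GP.
case: GP => LG G0 _ mG; exists G; split; [exact: LG|exact: G0| |].
- apply: (le_trans mG); rewrite ge0_ler_powR ?nnegrE//.
  + exact/ltW/side_gt0.
  + by rewrite mulr_ge0 ?powR_ge0// ltW.
  rewrite /side /C1 -mulrA ler_wpM2l ?exprn_ge0 ?(ltW D0)//.
  have nh0 : 0 <= n%:R * h by lra.
  rewrite -(sqrt_powR_pow nh0) -powRM ?mulr_ge0 ?exprn_ge0 ?(ltW B0)//.
  rewrite ge0_ler_powR ?nnegrE ?mulr_ge0 ?exprn_ge0 ?(ltW B0)//.
  rewrite -mulrA ler_wpM2l ?(ltW B0)// -exprMn /vol sum_nat_const card_ord mulnC exprM.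
  have tn : 0 <= 10 * (n%:R * h) by rewrite mulr_ge0.
  rewrite lerXn2r ?nnegrE ?exprn_ge0//.
  by apply: le_trans r2 _; rewrite -mulrA; move: (n%:R * h) nh => z; lra.
- move=> x delta dh xy delta0 w.
  have [l|a [v [av Q]]] := sP x; first exact: le_trans (xy l) dh.
  rewrite (noise_sum_box w h0 Q).
  set Qs := pbox _ _.
  have -> : \sum_(i in Qs) eps (lam_idx i) w * K (clip \o (fun l => (x l - lam_pt i l) / h)) =
      setsum X Qs w + \sum_(i in Qs) eps (lam_idx i) w *
       (K (clip \o (fun l => (x l - lam_pt i l) / h)) - cc i).
    by rewrite /setsum -big_split /=; apply: eq_bigr => i _; rewrite /X; ring.
  apply: le_trans (ler_normD _ _) _; apply: lerD; first exact: Gbox.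
  apply: le_trans (ler_norm_sum _ _ _) _.
  rewrite /abs_sum mulr_sumr [leLHS]big_mkcond /=; apply: ler_sum => i _.
  have dh0 : 0 <= delta / h by rewrite divr_ge0// ltW.
  case: ifP => _; last by rewrite mulr_ge0// mulr_ge0// ltW.
  rewrite normrM mulrC ler_wpM2r//.
  have [_] := KC (fun l => (x l - lam_pt i l) / h) (fun l => (y l - lam_pt i l) / h).
  apply => // l; rewrite -mulrBl opprB addrA subrK normrM normfV (gtr0_norm h0).
  by rewrite ler_pM2r ?invr_gt0.
Qed.

End cell_bound.

(** * Series and logarithms *)

Section almost_sure_bounds.
Context {R : realType} {dO : measure_display} {Omega : measurableType dO}.
Context (P : probability Omega R).

(** Borel-Cantelli in integral form: by monotone convergence the sum of the series is integrable,
    hence almost surely finite. *)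
Lemma ae_bounded_sums (f : nat -> Omega -> R) (a : nat -> R) (M : R) :
  (forall n, itg P (f n)) -> (forall n w, 0 <= f n w) -> (forall n, \int[P]_w f n w <= a n) ->
  (forall N, \sum_(k < N) a k <= M) ->
  {ae P, forall w, exists B : R, forall N, \sum_(k < N) f k w <= B}.
Proof.
move=> fi f0 fa aM.
pose F w := (\sum_(0 <= k <oo) (f k w)%:E)%E.
have mf n : measurable_fun setT (EFin \o f n) by case/integrableP: (fi n).
have F0 w : (0 <= F w)%E by apply: nneseries_ge0 => k _ _; rewrite lee_fin.
have IF : (\int[P]_w F w = \sum_(0 <= k <oo) \int[P]_w (f k w)%:E)%E.
  by apply: integral_nneseries => // k w _; rewrite lee_fin.
have IFM : (\int[P]_w F w <= M%:E)%E.
  rewrite IF; apply: lime_le.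
    by apply: is_cvg_nneseries => k _ _; apply: integral_ge0 => w _; rewrite lee_fin.
  near=> N; rewrite big_mkord.
  apply: (@le_trans _ _ (\sum_(k < N) (a k)%:E)%E); last by rewrite sumEFin lee_fin.
  by apply: lee_sum => k _; rewrite -itg_fineK// lee_fin.
have mF : measurable_fun setT F.
  by apply: ge0_emeasurable_sum => [k w _ _|k _]; rewrite ?lee_fin//; exact: mf.
have iF : P.-integrable setT F.
  apply/integrableP; split=> //.
  apply: le_lt_trans (ltry M); apply: le_trans IFM.
  rewrite le_eqVlt; apply/orP; left; apply/eqP; apply: eq_integral => w _.
  by rewrite gee0_abs.
have := integrable_ae measurableT iF; apply: filterS => w /(_ I) Ffin.
exists (fine (F w)) => N; rewrite -lee_fin fineK// -sumEFin -(big_mkord xpredT (fun k => (f k w)%:E)).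
by apply: nneseries_lim_ge => k _; rewrite lee_fin.
Unshelve. all: by end_near.
Qed.

Lemma bounded_sums_eventually_le1 (u : nat -> R) (B : R) : (forall n, 0 <= u n) ->
  (forall N, \sum_(k < N) u k <= B) -> \forall n \near \oo, u n <= 1.
Proof.
move=> u0 uB.
have cvgs : cvgn (series u).
  apply: nondecreasing_is_cvgn.
    by apply/nondecreasing_seqP => n; rewrite /series /= big_nat_recr//= lerDl.
  by exists B => _ [n _ <-]; rewrite /series /= big_mkord.
have := cvg_series_cvg_0 cvgs => /cvgrPdist_le /(_ 1 ltr01).
apply: filterS => n; rewrite sub0r normrN ger0_norm//.
Qed.

End almost_sure_bounds.

(** * Logarithmic series and comparison of powers with logarithms *)

Section logarithms.
Context {R : realType}.
Implicit Types x y t : R.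

Lemma ln_le_sub1 x : 0 < x -> ln x <= x - 1.
Proof.
move=> x0; have := @expR_ge1Dx R (ln x); rewrite lnK ?posrE//; lra.
Qed.

(** Convexity of the power [- t], compared with its tangent at [y]. *)
Lemma powRN_tangent t x y : 0 < t -> 0 < x -> x <= y ->
  t * (y - x) * (y * y `^ t)^-1 <= (x `^ t)^-1 - (y `^ t)^-1.
Proof.
move=> t0 x0 xy; have y0 := lt_le_trans x0 xy.
have xt := powR_gt0 t x0; have yt := powR_gt0 t y0.
have r0 : 0 < x / y by rewrite divr_gt0.
have H : 1 + t * (1 - x / y) <= (x `^ t)^-1 * y `^ t.
  have -> : (x `^ t)^-1 * y `^ t = expR (- (t * ln (x / y))).
    rewrite ln_div ?posrE// mulrBr opprB expRB mulrC /powR !gt_eqF//.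
  apply: le_trans (expR_ge1Dx _); rewrite lerD2l -[leRHS]mulrN ler_pM2l// lerNr opprB.
  exact: ln_le_sub1.
rewrite -(@ler_pM2r _ (y `^ t))//.
rewrite mulrBl mulVf ?gt_eqF//; move: H; rewrite -lerBrDl; apply: le_trans.
by rewrite le_eqVlt; apply/orP; left; apply/eqP; field; rewrite !gt_eqF.
Qed.

(* The guard keeps [ln k] positive for the telescoping argument. *)
Definition log_weight t (k : nat) : R :=
  if (k < 3)%N then 0 else (k%:R * (ln k%:R * (ln k%:R) `^ t))^-1.

Lemma ln_gt0_nat (k : nat) : (2 <= k)%N -> 0 < ln k%:R :> R.
Proof. by move=> k2; rewrite ln_gt0// ltr1n. Qed.

Lemma log_weight_ge0 t k : 0 <= log_weight t k.
Proof.
rewrite /log_weight; case: ltnP => // k3.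
by rewrite invr_ge0 !mulr_ge0 ?powR_ge0// ltW// ln_gt0_nat//; lia.
Qed.

(** The integral test by telescoping: [q] is the antiderivative of the weight up to sign, shifted by
    one, and [powRN_tangent] is applied to consecutive logarithms, whose gap is at least
    [1 / (k + 1)]. *)
Lemma log_weight_sum t : 0 < t -> exists M : R, forall N, \sum_(k < N) log_weight t k <= M.
Proof.
move=> t0; pose q k : R := t^-1 * ((ln k.-1%:R) `^ t)^-1.
have q0 k : 0 <= q k by rewrite mulr_ge0 ?invr_ge0 ?powR_ge0// ltW.
have tel k : (3 <= k)%N -> log_weight t k <= q k - q k.+1.
  move=> k3; rewrite /log_weight ltnNge k3 /= /q /=.
  case: k k3 => // k k3; rewrite [k.+1.-1]/=.
  have k0 : 0 < k%:R :> R by rewrite ltr0n; lia.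
  have k1 : 0 < k.+1%:R :> R by rewrite ltr0n.
  have lk : 0 < ln k%:R :> R by exact: ln_gt0_nat.
  have lk1 : 0 < ln k.+1%:R :> R by apply: ln_gt0_nat; lia.
  have lkk : ln k%:R <= ln k.+1%:R :> R by rewrite ler_ln ?posrE// ler_nat.
  have := powRN_tangent t0 lk lkk.
  have gap : k.+1%:R^-1 <= ln k.+1%:R - ln k%:R :> R.
    have := @ln_le_sub1 (k%:R / k.+1%:R) (divr_gt0 k0 k1).
    rewrite ln_div ?posrE//.
    have -> : k%:R / k.+1%:R - 1 = - k.+1%:R^-1 :> R.
      by rewrite -[k.+1%:R]natr1; field; rewrite natr1 gt_eqF.
    by rewrite -[_ <= ln _ - _]lerN2 opprB.
  rewrite -(@ler_pM2l _ t^-1) ?invr_gt0// -mulrBr; apply: le_trans.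
  rewrite -[X in t^-1 * X]mulrA mulKf ?gt_eqF//.
  rewrite invfM ler_wpM2r// invr_ge0 mulr_ge0 ?powR_ge0// ltW//.
exists (q 3) => N.
have [N3|N3] := ltnP N 3.
  rewrite big1// => k _; rewrite /log_weight (leq_ltn_trans _ N3)// ltnW//.
rewrite -(big_mkord xpredT (log_weight t)).
rewrite (big_cat_nat (n := 3))//= [X in X + _]big_nat_cond big1 ?add0r; last first.
  by move=> k; rewrite andbT => /andP[_ k3]; rewrite /log_weight k3.
rewrite big_nat_cond; apply: (@le_trans _ _ (\sum_(3 <= k < N) (q k - q k.+1))).
  rewrite [leRHS]big_nat_cond; apply: ler_sum => k; rewrite andbT => /andP[k3 _]; exact: tel.
have -> : \sum_(3 <= k < N) (q k - q k.+1) = q 3 - q N.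
  have := @telescope_sumr _ 3 N q N3 => E.
  by rewrite -[RHS]opprB -E -sumrN; apply: eq_bigr => k _; rewrite opprB.
by rewrite lerBlDr lerDl.
Qed.

Lemma powR_log_small (al be e : R) : 0 < al -> 0 < be -> 0 < e ->
  \forall n \near \oo, n%:R `^ (- be) * (ln n%:R) `^ al <= e.
Proof.
move=> al0 be0 e0.
(* Chosen so that bounding [ln (c * L)] by [c * L - 1], with [L = ln n], spends half of the decay
   [be * L]; beyond [T] the other half absorbs all constants. *)
pose c := be / (2 * al); have c0 : 0 < c by rewrite divr_gt0// mulr_gt0.
pose T := (- (al * (1 + ln c)) - ln e) / (be / 2).
near=> n.
have n2 : (2 <= n)%N by near: n; exists 2%N.
have n0 : 0 < n%:R :> R by rewrite ltr0n; lia.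
have l0 := ln_gt0_nat n2.
have lT : T <= ln n%:R.
  have : expR T <= n%:R by near: n; exact: nbhs_infty_ger.
  by move=> H; rewrite -[leLHS]expRK ler_ln ?posrE ?expR_gt0.
rewrite /powR !gt_eqF// -expRD -[leRHS]lnK ?posrE// ler_expR.
have := @ln_le_sub1 (c * ln n%:R) (mulr_gt0 c0 l0); rewrite lnM ?posrE//.
move: (ln (ln n%:R)) => L2; move: (ln n%:R) l0 lT => L l0 lT H.
have h2 : al * L2 <= al * (c * L - 1 - ln c) by rewrite ler_pM2l//; lra.
have h3 : al * (c * L) = be / 2 * L by rewrite /c; field; rewrite gt_eqF.
have h4 : T * (be / 2) <= L * (be / 2) by rewrite ler_pM2r// divr_gt0.
have h5 : T * (be / 2) = - (al * (1 + ln c)) - ln e.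
  by rewrite /T mulfVK// gt_eqF// divr_gt0.
rewrite h5 in h4.
move: h2; rewrite !mulrBr h3 mulr1 => h2; move: h4; rewrite mulrDr mulr1.
by lra.
Unshelve. all: by end_near.
Qed.

End logarithms.

(** * Uniform bound at a fixed sample size *)

Section uniform_step.
Context {R : realType} {dO : measure_display} {Omega : measurableType dO}.
Context (P : probability Omega R) {d : nat} (eps : Zd d -> Omega -> R) (p : R).
Context (p2 : 2 < p) (me : forall i, measurable_fun setT (eps i)).
Context (st : strictly_stationary P eps) (Z : nat -> Omega -> R) (kappa : R).
Context (C3 : C3_bound P eps p Z kappa) (K : ('I_d -> R) -> R) (A1 : assumption_A1 K).

(** There are [M.+2] centres per direction because the truncation equals [M.+1] when a coordinate is
    1. *)
Lemma grid_center (M : nat) (x : 'I_d -> R) : cube 0 1 x ->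
  exists m : {ffun 'I_d -> 'I_M.+2}, forall l, `|x l - (m l)%:R / M.+1%:R| <= M.+1%:R^-1.
Proof.
move=> xc; have M0 : 0 < M.+1%:R :> R by rewrite ltr0n.
exists [ffun l => inord (Num.truncn (x l * M.+1%:R))] => l.
have /andP[x0 x1] := xc l.
have t0 : 0 <= x l * M.+1%:R by rewrite mulr_ge0// ltW.
have /andP[t1 t2] := truncn_itv t0.
have tM : (Num.truncn (x l * M.+1%:R) < M.+2)%N.
  rewrite ltnS -(ler_nat R); apply: le_trans t1 _.
  by rewrite ler_piMl// ltW.
rewrite ffunE inordK//; set k := Num.truncn _ in t1 t2 *.
have e1 : k%:R / M.+1%:R <= x l by rewrite ler_pdivrMr.
have e2 : x l <= k%:R / M.+1%:R + M.+1%:R^-1.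
  by rewrite -[X in _ + X]mul1r -mulrDl natr1 ler_pdivlMr// ltW.
rewrite ler_norml; apply/andP; split; last by rewrite lerBlDl.
by apply: (@le_trans _ _ 0); [rewrite oppr_le0 invr_ge0 ltW|rewrite subr_ge0].
Qed.

Lemma kernel_ub : exists2 C : R, 0 < C & forall z, 0 <= K z <= C.
Proof.
case: (A1) => K0 _ Kout _ [c [C [c0 C0 cC]]]; exists C => // z; rewrite K0/=.
have [zc|zc] := pselect (cube (-1) 1 z); first by have /andP[] := cC _ zc.
by rewrite Kout// ltW.
Qed.

Lemma step_algebra (n h v c T S : R) : 0 < n -> 0 < h -> 0 < c ->
  (T * ((n * h) ^+ d * v) + S * (v * h ^+ (2 * d)%N)) / (c * (n * h) ^+ d) =
  v * (T / c + (c^-1 * (h ^+ d * (S / n ^+ d)))).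
Proof.
move=> n0 h0 c0; rewrite exprMn mulnC exprM expr2.
have nd : n ^+ d != 0 by rewrite expf_neq0 ?gt_eqF.
have hd : h ^+ d != 0 by rewrite expf_neq0 ?gt_eqF.
by move: (n ^+ d) (h ^+ d) nd hd => N H nd hd; field; rewrite nd hd gt_eqF.
Qed.

(* The cells have width [delta = v h^(2d+1)]: the oscillation of the kernel inside a cell then
   contributes [v h^d] times the mean of the [|eps|]. If [delta > h], then [1 <= v h^(2d)] and the
   crude bound of the sum by the sum of the absolute values suffices. *)
Lemma step_bound : exists c1 c2 c3 : R, [/\ 0 < c1, 0 < c2, 0 < c3 &
  forall (n : nat) (h v : R), (0 < n)%N -> 0 < h <= 1 / 2 -> 2 <= n%:R * h -> 0 < v ->
  exists f : Omega -> R, [/\ itg P f, (forall w, 0 <= f w),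
    \int[P]_w f w <= c3 * ((v * h ^+ (2 * d).+1) ^+ d)^-1 * (((n%:R * h) `^ (d%:R / 2) * v) `^ p)^-1 &
    forall w, f w <= 1 -> forall x, cube 0 1 x ->
      `|noise_sum eps K n h x w / \sum_(i : {ffun 'I_d -> 'I_n}) kweight K h x i| <=
      v * (c1 + c2 * (h ^+ d * (abs_sum eps n w / n%:R ^+ d)))]].
Proof.
have hp := p2; have p0 : 0 < p by lra.
have [C1 [C2 [C10 C20 cell]]] := cell_bound p2 me st C3 A1.
have [c c0 Dge] := sum_kweight_ge A1.
have [C C0 KC] := kernel_ub.
have c1_gt0 : 0 < 2 ^+ d / c by rewrite divr_gt0// exprn_gt0.
have c2_gt0 : 0 < (C + C2) / c by rewrite divr_gt0// addr_gt0.
have c3_gt0 : 0 < 3 ^+ d * C1 `^ p by rewrite mulr_gt0 ?powR_gt0// exprn_gt0.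
exists (2 ^+ d / c), ((C + C2) / c), (3 ^+ d * C1 `^ p); split => // n h v n0 /andP[h0 h1] nh v0.
have n0' : 0 < n%:R :> R by rewrite ltr0n.
have nhd0 : 0 < (n%:R * h) ^+ d by rewrite exprn_gt0// mulr_gt0.
have hh : 0 < h <= 1 / 2 by rewrite h0.
set delta := v * h ^+ (2 * d).+1.
have delta0 : 0 < delta by rewrite mulr_gt0// exprn_gt0.
(* Common end of both cases. Wide cells supply [T = 0] and [S] with constant [C], narrow ones
   [T = 2 ^+ d] and [S] with constant [C2]; this explains the two constants of the conclusion. *)
have quot w (x : 'I_d -> R) (T S : R) : cube 0 1 x -> 0 <= T -> 0 <= S ->
    T <= 2 ^+ d -> S <= (C + C2) * abs_sum eps n w ->
    `|noise_sum eps K n h x w| <= T * ((n%:R * h) ^+ d * v) + S * (v * h ^+ (2 * d)%N) ->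
    `|noise_sum eps K n h x w / \sum_(i : {ffun 'I_d -> 'I_n}) kweight K h x i| <=
      v * (2 ^+ d / c + (C + C2) / c * (h ^+ d * (abs_sum eps n w / n%:R ^+ d))).
  move=> xc T0 S0 T1 S1 H; have D := Dge n h x xc hh nh.
  have cD : 0 < c * (n%:R * h) ^+ d by rewrite mulr_gt0.
  have D0 := le_trans (ltW cD) D.
  rewrite normrM normfV (ger0_norm D0).
  apply: (@le_trans _ _ (`|noise_sum eps K n h x w| / (c * (n%:R * h) ^+ d))).
    by rewrite ler_wpM2l// lef_pV2// posrE//; exact: lt_le_trans D.
  apply: (@le_trans _ _ ((T * ((n%:R * h) ^+ d * v) + S * (v * h ^+ (2 * d)%N)) / (c * (n%:R * h) ^+ d))).
    by rewrite ler_wpM2r// invr_ge0 ltW.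
  rewrite step_algebra// (ler_wpM2l (ltW v0))//; apply: lerD.
    by rewrite ler_wpM2r// invr_ge0 ltW.
  rewrite [(C + C2) / c]mulrC -mulrA ler_wpM2l ?invr_ge0 ?(ltW c0)//.
  rewrite [leRHS]mulrCA ler_wpM2l ?exprn_ge0 ?(ltW h0)// mulrA ler_wpM2r//.
have [dh|hd] := leP delta h; last first.
  have rhs0 : 0 <= 3 ^+ d * C1 `^ p * (delta ^+ d)^-1 * (((n%:R * h) `^ (d%:R / 2) * v) `^ p)^-1.
    by rewrite mulr_ge0 ?invr_ge0 ?powR_ge0// mulr_ge0 ?(ltW c3_gt0)// invr_ge0 exprn_ge0// ltW.
  exists (fun=> 0); split => //; first exact: itg_cst.
    by rewrite Rintegral_cst// mul0r.
  move=> w _ x xc; apply: (quot w x 0 (C * abs_sum eps n w)) => //.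
  - by rewrite mulr_ge0 ?abs_sum_ge0// ltW.
  - by rewrite ler_wpM2r ?abs_sum_ge0// lerDl ltW.
  rewrite mul0r add0r; apply: (@le_trans _ _ (C * abs_sum eps n w)).
    apply: le_trans (ler_norm_sum _ _ _) _; rewrite /abs_sum mulr_sumr.
    apply: ler_sum => i _; rewrite normrM mulrC ler_wpM2r//.
    by have /andP[k0 k1] := KC (fun l => (x l - lam_pt i l) / h); rewrite ger0_norm.
  rewrite ler_peMr ?mulr_ge0 ?abs_sum_ge0 ?(ltW C0)//.
  move: hd; rewrite /delta exprSr mulrA -[X in X < _]mul1r ltr_pM2r//; exact: ltW.
pose M := Num.truncn delta^-1.
have dM : M.+1%:R^-1 <= delta.
  by rewrite -[leRHS]invrK lef_pV2 ?posrE ?invr_gt0 ?ltr0n// ltW// truncnS_gt.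
(* As [delta <= h <= 1 / 2], the two extra centres cost at most [2 * delta^-1]; hence the factor
   [3 ^+ d]. *)
have M3 : M.+2%:R <= 3 * delta^-1.
  have id0 : 0 <= delta^-1 by rewrite invr_ge0 ltW.
  have /andP[t1 _] := truncn_itv id0.
  have d1 : 1 <= delta^-1 by rewrite invf_ge1//; lra.
  rewrite (_ : M.+2%:R = M%:R + 2); last by rewrite -addn2 natrD.
  by move: t1; rewrite -/M; move: (delta^-1) d1 => z; lra.
pose ctr (m : {ffun 'I_d -> 'I_M.+2}) : 'I_d -> R := fun l => (m l)%:R / M.+1%:R.
have nh1 : 1 <= n%:R * h by lra.
have /choice[G GP] m := cell n h (ctr m) n0 h0 nh1.
pose T := (n%:R * h) ^+ d * v.
have T0 : 0 < T by rewrite mulr_gt0.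
have Tp : 0 < T `^ p by rewrite powR_gt0.
(* Markov's inequality and the union bound in one function: all terms are nonnegative, so [f w <= 1]
   forces [G m w <= T] for every cell. *)
pose f w := \sum_m (T `^ p)^-1 * `|G m w| `^ p.
have fi m : itg P (fun w => (T `^ p)^-1 * `|G m w| `^ p).
  by apply: itgZ; have [[]] := GP m.
have f0 m w : 0 <= (T `^ p)^-1 * `|G m w| `^ p by rewrite mulr_ge0 ?powR_ge0// invr_ge0 powR_ge0.
exists f; split.
- exact: itg_sum.
- by move=> w; exact: sumr_ge0.
- rewrite Rint_sum//.
  set Q := (n%:R * h) `^ (d%:R / 2).
  have Q0 : 0 < Q by rewrite powR_gt0// mulr_gt0.
  have TQ : T = Q * (Q * v).
    rewrite /T mulrA; congr (_ * _); have nhp : 0 < n%:R * h by rewrite mulr_gt0.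
    rewrite /Q -powRD; last by rewrite (gt_eqF nhp) implybT.
    by rewrite -splitr powR_mulrn// mulr_ge0// ltW.
  apply: (@le_trans _ _ (\sum_(m : {ffun 'I_d -> 'I_M.+2}) (T `^ p)^-1 * (C1 * Q) `^ p)).
    apply: ler_sum => m _; have [LG _ mG _] := GP m.
    by rewrite RintegralZl//; [rewrite (ler_wpM2l _ mG)// invr_ge0 powR_ge0|exact: LG.2].
  rewrite sumr_const card_ffun !card_ord -[leLHS]mulr_natr.
  have -> : (T `^ p)^-1 * (C1 * Q) `^ p = C1 `^ p * ((Q * v) `^ p)^-1.
    rewrite TQ powRM ?(ltW Q0)// ?mulr_ge0 ?(ltW Q0) ?(ltW v0)//.
    rewrite (powRM _ (ltW C10) (ltW Q0)).
    have q0 : Q `^ p != 0 by rewrite gt_eqF// powR_gt0.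
    have qv0 : (Q * v) `^ p != 0 by rewrite gt_eqF// powR_gt0// mulr_gt0.
    by move: (Q `^ p) ((Q * v) `^ p) q0 qv0 => A B a0 b0; field; rewrite a0 b0.
  rewrite (_ : _ * (delta ^+ d)^-1 * _ = C1 `^ p * ((Q * v) `^ p)^-1 * (3 ^+ d * (delta ^+ d)^-1)); last by ring.
  rewrite ler_wpM2l//; first by rewrite mulr_ge0 ?powR_ge0// invr_ge0 powR_ge0.
  rewrite natrX -exprVn -exprMn lerXn2r ?nnegrE//.
  by rewrite mulr_ge0// invr_ge0 ltW.
- move=> w fw x xc; have [m mx] := grid_center M xc.
  have [LG G0 _ bnd] := GP m.
  have Gm : G m w <= T.
    have : `|G m w| `^ p <= T `^ p.
      have : (T `^ p)^-1 * `|G m w| `^ p <= 1.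
        apply: le_trans fw; rewrite /f (bigD1 m)//= lerDl.
        by apply: sumr_ge0 => j _; exact: f0.
      by rewrite mulrC ler_pdivrMr// mul1r.
    rewrite ger0_norm//; apply: contraTT; rewrite -!ltNge => TG.
    by apply: gt0_ltr_powR => //; rewrite nnegrE// ltW.
  have xm l : `|x l - ctr m l| <= delta by exact: le_trans (mx l) dM.
  apply: (quot w x (2 ^+ d) (C2 * abs_sum eps n w)) => //.
  + by rewrite mulr_ge0 ?abs_sum_ge0// ltW.
  + by rewrite ler_wpM2r ?abs_sum_ge0// lerDr ltW.
  apply: le_trans (bnd x delta dh xm (ltW delta0) w) _; apply: lerD.
    by rewrite ler_wpM2l ?exprn_ge0.
  rewrite [leLHS]mulrAC ler_wpM2l ?mulr_ge0 ?abs_sum_ge0 ?(ltW C20)//.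
  by rewrite /delta exprSr mulrA mulfK// gt_eqF.
Qed.

Lemma abs_sum_mono (n m : nat) w : (n <= m)%N -> abs_sum eps n w <= abs_sum eps m w.
Proof.
move=> nm; pose e (i : {ffun 'I_d -> 'I_n}) : {ffun 'I_d -> 'I_m} := [ffun l => widen_ord nm (i l)].
have einj : injective e.
  move=> i j /ffunP H; apply/ffunP => l; apply/val_inj.
  by have := H l; rewrite !ffunE => /(congr1 val).
have -> : abs_sum eps n w = \sum_(j in (e @: predT)%SET) `|eps (lam_idx j) w|.
  rewrite big_imset /=; last by move=> i j _ _; exact: einj.
  apply: eq_big => // i _; congr (`|eps _ w|).
  by apply/ffunP => l; rewrite !ffunE.
by rewrite [leRHS](bigID (mem (e @: predT)%SET))/= lerDl sumr_ge0.
Qed.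

Lemma mom1_eps i : \int[P]_w `|eps i w| = \int[P]_w `|eps (zd0 d) w|.
Proof.
have := mom_eps 1 me st i; rewrite /mom.
by under eq_Rintegral do rewrite powRr1//; under [in X in _ = X -> _]eq_Rintegral do rewrite powRr1//.
Qed.

Lemma itg_abs_eps i : itg P (fun w => `|eps i w|).
Proof.
have [L0 _ _ _] := C3; apply: itg_norm; apply: Lp_itg (Lp_eps me st i L0).
by have hp := p2; lra.
Qed.

Lemma abs_sum_mean (n : nat) : (0 < n)%N ->
  \int[P]_w (abs_sum eps n w / n%:R ^+ d) = \int[P]_w `|eps (zd0 d) w|.
Proof.
move=> n0; rewrite RintegralZr//; last by apply: itg_sum => i; exact: itg_abs_eps.
rewrite /abs_sum Rint_sum; last by move=> i; exact: itg_abs_eps.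
under eq_bigr do rewrite mom1_eps.
rewrite sumr_const card_ffun !card_ord -[_ *+ _]mulr_natr natrX mulfK//.
by rewrite expf_neq0// pnatr_eq0 -lt0n.
Qed.

Lemma ln_double (n : nat) : (2 <= n)%N -> ln (2 * n)%:R <= 2 * ln n%:R :> R.
Proof.
move=> n2; have n0 : 0 < n%:R :> R by rewrite ltr0n; lia.
rewrite natrM lnM ?posrE// mulr_natl [leRHS]mulr2n lerD2r ler_ln ?posrE//.
by rewrite ler_nat.
Qed.

(* Summing [abs_sum k / k^d] against [1 / (k ln^2 k)] replaces the ergodic theorem: the power [h^d]
   absorbs the logarithms that are lost. *)
Lemma abs_sum_growth : {ae P, forall w, exists B : R, forall n, (3 <= n)%N ->
  abs_sum eps n w / n%:R ^+ d <= B * ln n%:R ^+ 2}.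
Proof.
have [M sumM] := @log_weight_sum R 1 ltr01.
pose e0 := \int[P]_w `|eps (zd0 d) w|.
have e00 : 0 <= e0 by exact: Rintegral_ge0.
pose W k w := abs_sum eps k w / k%:R ^+ d.
have W0 k w : 0 <= W k w by rewrite mulr_ge0 ?abs_sum_ge0// invr_ge0 exprn_ge0.
have iW k : itg P (W k).
  have : itg P (fun w => (k%:R ^+ d)^-1 * abs_sum eps k w).
    by apply: itgZ; apply: itg_sum => i; exact: itg_abs_eps.
  by congr (itg P _); apply/funext => w; rewrite mulrC.
have := @ae_bounded_sums _ _ _ P (fun k w => log_weight 1 k * W k w)
  (fun k => log_weight 1 k * e0) (M * e0) _ _ _ _.
case.
- by move=> k; exact: itgZ.
- by move=> k w; rewrite mulr_ge0 ?log_weight_ge0.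
- move=> k; rewrite RintegralZl//; last exact: iW.
  have [k0|k0] := posnP k; last by rewrite /W abs_sum_mean.
  by rewrite k0 /log_weight !mul0r.
- by move=> N; rewrite -mulr_suml ler_wpM2r.
move=> N0 [mN0 PN0 sub]; exists N0; split => // w nw; apply: sub => /= H; apply: nw.
(* On [n <= k < 2 * n] each of the [n] terms is at least [q], because [abs_sum] grows with [k].
   Replacing [k] by [2 * n] in the denominators costs [2 ^+ d.+1], and [ln (2 * n) <= 2 * ln n]
   costs 4. *)
case: H => B HB; exists (2 ^+ d.+1 * 4 * B) => n n3.
have n0 : 0 < n%:R :> R by rewrite ltr0n; lia.
have n2 : (2 <= n)%N by lia.
have l0 : 0 < ln n%:R :> R by exact: ln_gt0_nat.
have l2 : 0 < ln (2 * n)%:R :> R by apply: ln_gt0_nat; lia.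
have n2r : 0 < (2 * n)%:R :> R by rewrite ltr0n; lia.
pose q := ((2 * n)%:R * ln (2 * n)%:R ^+ 2)^-1 * ((2 ^+ d)^-1 * W n w).
have q0 : 0 <= q.
  apply: mulr_ge0; first by rewrite invr_ge0 mulr_ge0 ?sqr_ge0.
  by rewrite mulr_ge0// invr_ge0.
have B0 : 0 <= B by have := HB 0%N; rewrite big_ord0.
have nq : n%:R * q <= B.
  apply: le_trans (HB (2 * n)%N); rewrite -(big_mkord xpredT (fun k => log_weight 1 k * W k w)).
  rewrite (big_cat_nat (n := n))//=; last by lia.
  rewrite -[leLHS]add0r; apply: lerD.
    by apply: sumr_ge0 => k _; rewrite mulr_ge0 ?log_weight_ge0.
  have -> : n%:R * q = \sum_(n <= k < 2 * n) q.
    by rewrite sumr_const_nat (_ : 2 * n - n = n)%N ?mulr_natl//; lia.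
  apply: ler_sum_nat => k /andP[nk kn].
  have k0 : 0 < k%:R :> R by rewrite ltr0n; lia.
  have lk : 0 < ln k%:R :> R by apply: ln_gt0_nat; lia.
  have kn' : k%:R <= (2 * n)%:R :> R by rewrite ler_nat ltnW.
  have lkn : ln k%:R <= ln (2 * n)%:R :> R by rewrite ler_ln ?posrE.
  apply: ler_pM.
  - by rewrite invr_ge0 mulr_ge0 ?exprn_ge0// ltW.
  - by rewrite mulr_ge0// invr_ge0 exprn_ge0.
  - rewrite /log_weight ltnNge (leq_trans n3 nk)/= powRr1 ?(ltW lk)//.
    rewrite lef_pV2 ?posrE ?mulr_gt0 ?exprn_gt0//.
    by apply: ler_pM; rewrite ?mulr_ge0 ?(ltW k0) ?(ltW lk)// expr2; apply: ler_pM; rewrite ?(ltW lk).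
  - rewrite /W mulrA [X in X <= _]mulrAC mulrC; apply: ler_pM.
    + exact: abs_sum_ge0.
    + by rewrite mulr_ge0// invr_ge0 exprn_ge0.
    + exact: abs_sum_mono.
    rewrite -invfM -exprMn lef_pV2 ?posrE ?exprn_gt0 ?mulr_gt0//.
    by rewrite lerXn2r ?nnegrE// ?mulr_ge0// -natrM.
have -> : abs_sum eps n w / n%:R ^+ d = (n%:R * q) * (2 ^+ d.+1 * ln (2 * n)%:R ^+ 2).
  rewrite /q -/(W n w) (exprS (2 : R) d) natrM.
  have d0 : 2 ^+ d != 0 :> R by rewrite expf_neq0.
  have l20 : ln (2 * n)%:R != 0 :> R by rewrite gt_eqF.
  rewrite natrM in l20.
  by move: (W n w) (2 ^+ d) d0 (ln _) l20 => x y y0 z z0; field; rewrite y0 z0 gt_eqF.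
apply: (@le_trans _ _ (B * (2 ^+ d.+1 * (4 * ln n%:R ^+ 2)))).
  apply: ler_pM => //.
  - by rewrite mulr_ge0.
  - by rewrite mulr_ge0 ?sqr_ge0.
  rewrite ler_wpM2l ?exprn_ge0//.
  have -> : 4 * ln n%:R ^+ 2 = (2 * ln n%:R) ^+ 2 :> R by ring.
  by rewrite lerXn2r ?nnegrE ?(ltW l2) ?ln_double// mulr_ge0// ltW.
by rewrite le_eqVlt; apply/orP; left; apply/eqP; ring.
Qed.

End uniform_step.

(** * Rates *)

Section rates.
Context {R : realType}.
Lemma powR_exp (x y : R) : 0 < x -> x `^ y = expR (y * ln x).
Proof. by move=> x0; rewrite /powR gt_eqF. Qed.

Lemma expR_pow (x : R) (d : nat) : expR x ^+ d = expR (d%:R * x).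
Proof. by rewrite -expRM_natl mulr_natl. Qed.

Lemma bandwidth_exp (theta1 theta2 : R) (n : nat) : (3 <= n)%N ->
  n%:R `^ (- theta2) * (ln n%:R) `^ theta1 = expR (- theta2 * ln n%:R + theta1 * ln (ln n%:R)).
Proof.
move=> n3; have n0 : 0 < n%:R :> R by rewrite ltr0n; lia.
have l0 : 0 < ln n%:R :> R by apply: ln_gt0_nat; lia.
by rewrite (powR_exp _ n0) (powR_exp _ l0) expRD.
Qed.

(** Both sides are exponentials of linear forms in [ln n] and [ln (ln n)]. The choice of [t] makes
    the coefficients of [ln (ln n)] equal, so only those of [ln n] are compared. *)
Lemma rate_bound (a b p theta1 theta2 h v t : R) (d n : nat) : (0 < d)%N -> 2 < p -> (3 <= n)%N ->
  theta2 <= (2 * a * (d%:R + p) - d%:R ^+ 2 - 2) / (d%:R * (3 * d%:R + 2)) ->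
  h = n%:R `^ (- theta2) * (ln n%:R) `^ theta1 ->
  v = n%:R `^ a * (ln n%:R) `^ b / (n%:R * h) `^ (d%:R / 2) ->
  t = (d%:R * (3 * d%:R + 2) * theta1 + 2 * (d%:R + p) * b) / 2 - 1 ->
  ((v * h ^+ (2 * d).+1) ^+ d)^-1 * (((n%:R * h) `^ (d%:R / 2) * v) `^ p)^-1 <= log_weight t n.
Proof.
move=> d0 p2 n3 thetaP hdef vdef tdef.
have n0 : 0 < n%:R :> R by rewrite ltr0n; lia.
have l0 : 0 < ln n%:R :> R by apply: ln_gt0_nat; lia.
have hE : h = expR (- theta2 * ln n%:R + theta1 * ln (ln n%:R)) by rewrite hdef; exact: bandwidth_exp.
have nhE : n%:R * h = expR (ln n%:R + (- theta2 * ln n%:R + theta1 * ln (ln n%:R))).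
  by rewrite hE expRD lnK.
have vE : v = expR (a * ln n%:R + b * ln (ln n%:R) -
    d%:R / 2 * (ln n%:R + (- theta2 * ln n%:R + theta1 * ln (ln n%:R)))).
  by rewrite vdef nhE (powR_exp _ n0) (powR_exp _ l0) powR_exp ?expR_gt0// expRK expRB expRD.
rewrite /log_weight ltnNge n3 /= nhE vE hE.
rewrite (powR_exp _ (expR_gt0 _)) expRK expR_pow -expRD expR_pow -expRN.
rewrite -expRD (powR_exp _ (expR_gt0 _)) expRK -expRN -expRD.
have -> : (n%:R * (ln n%:R * (ln n%:R) `^ t))^-1 =
    expR (- (ln n%:R + (ln (ln n%:R) + t * ln (ln n%:R)))).
  by rewrite (powR_exp _ l0) expRN !expRD !lnK.
rewrite ler_expR.
have -> : (2 * d).+1%:R = 2 * d%:R + 1 :> R by rewrite -natr1 natrM.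
have dd : 0 < d%:R * (3 * d%:R + 2) :> R.
  by rewrite mulr_gt0 ?ltr0n// addr_gt0// mulr_gt0// ltr0n.
have {thetaP} : theta2 * (d%:R * (3 * d%:R + 2)) <= 2 * a * (d%:R + p) - d%:R ^+ 2 - 2.
  by rewrite -ler_pdivlMr.
rewrite -(@ler_pM2r _ (ln n%:R))// tdef.
move: (d%:R : R) dd (ln n%:R) l0 => D dd L l0; move: (ln L) => L2 H.
rewrite -subr_ge0 in H.
rewrite -subr_ge0.
set X := (X in 0 <= X); set Y := (X in 0 <= X) in H.
(* What remains after cancellation is half of the hypothesis on [theta2], multiplied by [ln n]. *)
have -> : X = Y / 2 by rewrite /X /Y; field.
by rewrite divr_ge0.
Qed.

Lemma rate_gt0 (a b h e : R) (n : nat) : (3 <= n)%N -> 0 < h ->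
  0 < n%:R `^ a * (ln n%:R) `^ b / (n%:R * h) `^ e.
Proof.
move=> n3 h0; have n0 : 0 < n%:R :> R by rewrite ltr0n; lia.
have l0 : 0 < ln n%:R :> R by apply: ln_gt0_nat; lia.
by rewrite divr_gt0 ?mulr_gt0 ?powR_gt0 ?mulr_gt0.
Qed.

Lemma bandwidth_log_small (theta1 theta2 : R) (d : nat) (e : R) : (0 < d)%N -> 0 < theta1 -> 0 < theta2 -> 0 < e ->
  \forall n \near \oo, (n%:R `^ (- theta2) * (ln n%:R) `^ theta1) ^+ d * ln n%:R ^+ 2 <= e.
Proof.
move=> d0 t1 t2 e0.
have dr : 0 < d%:R :> R by rewrite ltr0n.
have al0 : 0 < d%:R * theta1 + 2 by rewrite addr_gt0// mulr_gt0.
have be0 : 0 < d%:R * theta2 by rewrite mulr_gt0.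
have Hev := powR_log_small al0 be0 e0.
near=> n.
have n3 : (3 <= n)%N by near: n; exists 3%N.
have n0 : 0 < n%:R :> R by rewrite ltr0n; lia.
have l0 : 0 < ln n%:R :> R by apply: ln_gt0_nat; lia.
have H : n%:R `^ (- (d%:R * theta2)) * (ln n%:R) `^ (d%:R * theta1 + 2) <= e.
  by near: n.
apply: le_trans H; rewrite bandwidth_exp// expR_pow (powR_exp _ n0) (powR_exp _ l0).
rewrite -[X in _ * X ^+ 2](lnK l0) expR_pow -!expRD ler_expR le_eqVlt; apply/orP; left; apply/eqP.
by ring.
Unshelve. all: by end_near.
Qed.

Lemma limn_esup_le (u : nat -> \bar R) (l : \bar R) :
  (\forall n \near \oo, (u n <= l)%E) -> (limn_esup u <= l)%E.
Proof.
move=> [N _ NP]; rewrite limn_esup_lim; apply: lime_le; first exact: is_cvg_esups.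
exists N => // n /= Nn; apply: ge_ereal_sup => _ [k /= nk <-].
by apply: NP => /=; exact: leq_trans nk.
Qed.

End rates.

(** * Centering by the mean *)

Section centering.
Context {R : realType} {dO : measure_display} {Omega : measurableType dO}.
Context (P : probability Omega R) {d : nat} (eps : Zd d -> Omega -> R).
Context (me : forall i, measurable_fun setT (eps i)) (st : strictly_stationary P eps).
Context (ieps : forall i, itg P (eps i)) (E0 : ('E_P[eps (zd0 d)])%E = 0%E).

Lemma mean_eps i : \int[P]_w eps i w = 0.
Proof.
have mF : measurable_fun setT (EFin \o (fun x : @rectType R 'I_1 => x ord0)).
  by apply/measurable_EFinP; exact: measurable_coord.
have := stationary_integral (fun _ : 'I_1 => zd0 d) i me st mF.
have -> : zdadd (zd0 d) i = i by apply/ffunP => l; rewrite !ffunE add0r.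
rewrite /Rintegral => <-; move: E0; rewrite unlock => E.
by have -> : (\int[P]_w (EFin \o (fun x : @rectType R 'I_1 => x ord0)) (fun=> eps (zd0 d) w) = 0)%E by exact: E.
Qed.

(** The regression part is deterministic and the noise has mean zero. The identity also covers a
    vanishing denominator, since the inverse of 0 is 0. *)
Lemma g_est_center (g : ('I_d -> R) -> R) (K : ('I_d -> R) -> R) (h : nat -> R) (n : nat) x w :
  g_est g eps K h n x w - fine ('E_P[g_est g eps K h n x])%E =
  noise_sum eps K n (h n) x w / \sum_(i : {ffun 'I_d -> 'I_n}) kweight K (h n) x i.
Proof.
set D := \sum_(i : {ffun 'I_d -> 'I_n}) kweight K (h n) x i.
pose A := \sum_(i : {ffun 'I_d -> 'I_n}) g (lam_pt i) * kweight K (h n) x i.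
have gE w' : g_est g eps K h n x w' = A / D + D^-1 * noise_sum eps K n (h n) x w'.
  rewrite /g_est -/D [D^-1 * _]mulrC -mulrDl; congr (_ / _).
  by rewrite /A /noise_sum -big_split /=; apply: eq_bigr => i _; rewrite mulrDl.
have inoise : itg P (noise_sum eps K n (h n) x).
  apply: itg_sum => i; have := itgZ (kweight K (h n) x i) (ieps (lam_idx i)).
  by congr (itg P _); apply/funext => z; rewrite mulrC.
have mean0 : \int[P]_w noise_sum eps K n (h n) x w = 0.
  rewrite /noise_sum Rint_sum.
    by apply: big1 => i _; rewrite RintegralZr ?mean_eps ?mul0r//; exact: ieps.
  move=> i; have := itgZ (kweight K (h n) x i) (ieps (lam_idx i)).
  by congr (itg P _); apply/funext => z; rewrite mulrC.
have -> : fine ('E_P[g_est g eps K h n x])%E = A / D.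
  rewrite unlock; transitivity (\int[P]_w (A / D + D^-1 * noise_sum eps K n (h n) x w)).
    by congr fine; apply: eq_integral => z _; rewrite gE.
  rewrite RintegralD//; [|exact: itg_cst|exact: itgZ].
  have P1 : fine (P setT) = 1 :> R by rewrite probability_setT.
  rewrite [X in _ + X]RintegralZl// mean0 mulr0 addr0 Rintegral_cst//.
  by rewrite P1 mulr1.
by rewrite gE addrAC subrr add0r mulrC.
Qed.

End centering.

(** * The almost sure uniform rate *)

Theorem theorem1 (R : realType) (dO : measure_display) (Omega : measurableType dO)
  (P : probability Omega R) (d : nat) (eps : Zd d -> Omega -> R)
  (g : ('I_d -> R) -> R) (K : ('I_d -> R) -> R)
  (p theta1 theta2 a b : R) :
  (0 < d)%N ->
  (forall i, measurable_fun setT (eps i)) ->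
  strictly_stationary P eps ->
  ('E_P[eps (zd0 d)])%E = 0%E ->
  assumption_A1 K ->
  2 < p -> cond_C3 P eps p ->
  0 < theta1 -> 0 < theta2 ->
  let h := fun n : nat => n%:R `^ (- theta2) * (ln n%:R) `^ theta1 in
  h @ \oo --> 0 ->
  (fun n => n%:R * h n) @ \oo --> +oo ->
  0 <= a -> 0 <= b ->
  let v := fun n : nat => n%:R `^ a * (ln n%:R) `^ b / (n%:R * h n) `^ (d%:R / 2) in
  let theta := (2 * a * (d%:R + p) - d%:R ^+ 2 - 2) / (d%:R * (3 * d%:R + 2)) in
  theta2 <= theta ->
  d%:R * (3 * d%:R + 2) * theta1 + 2 * (d%:R + p) * b > 2 ->
  exists2 lambda : R, 0 < lambda &
    {ae P, forall w, (limn_esup (fun n =>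
        ereal_sup [set (`| g_est g eps K h n x w
                           - fine ('E_P[g_est g eps K h n x])%E |)%:E | x in @cube R d 0 1]
        * ((v n)^-1)%:E) <= lambda%:E)%E}.
Proof.
move=> d0 me st E0 A1 p2 C3c th1 th2 h h_cvg nh_cvg a0 b0 v theta thetaP logP.
have [Z [kappa C3]] := cond_C3_bound p2 me C3c.
have ieps i : itg P (eps i).
  by have [L0 _ _ _] := C3; apply: Lp_itg (Lp_eps me st i L0); lra.
have [c1 [c2 [c3 [c10 c20 c30 step]]]] := step_bound p2 me st C3 A1.
(* The factor multiplying [c2] in [step_bound] is eventually at most 1, so no random constant
   survives. *)
exists (c1 + c2); first exact: addr_gt0.
pose t := (d%:R * (3 * d%:R + 2) * theta1 + 2 * (d%:R + p) * b) / 2 - 1.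
have t0 : 0 < t by rewrite /t subr_gt0 ltr_pdivlMr// mul1r.
have [M sumM] := log_weight_sum t0.
(* The conditions of [step_bound] hold only for large [n]; for the other [n] the function chosen
   below is 0. *)
pose good n := [&& (3 <= n)%N, 0 < h n, h n <= 1 / 2 & 2 <= n%:R * h n].
pose dom n (f : Omega -> R) := [/\ itg P f, forall w, 0 <= f w,
  \int[P]_w f w <= c3 * log_weight t n &
  good n -> forall w, f w <= 1 -> forall x, cube 0 1 x ->
    `|noise_sum eps K n (h n) x w / \sum_(i : {ffun 'I_d -> 'I_n}) kweight K (h n) x i| <=
    v n * (c1 + c2 * (h n ^+ d * (abs_sum eps n w / n%:R ^+ d)))].
have v_gt0 n : good n -> 0 < v n.
  by move=> /and4P[n3 hn0 _ _]; exact: rate_gt0.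
have /choice[f fP] n : exists f, dom n f.
  have [gn|gn] := boolP (good n); last first.
    exists (fun=> 0); split => //; first exact: itg_cst.
    by rewrite Rintegral_cst// mul0r mulr_ge0 ?log_weight_ge0// ltW.
    by move=> gn'; rewrite gn' in gn.
  have /and4P[n3 hn0 hn1 nh2] := gn.
  have nn0 : (0 < n)%N by rewrite (leq_trans _ n3).
  have hh : 0 < h n <= 1 / 2 by rewrite hn0.
  have [f [fi f0 fint fb]] := step n (h n) (v n) nn0 hh nh2 (v_gt0 n gn).
  exists f; split => //; apply: le_trans fint _; rewrite -mulrA ler_wpM2l ?(ltW c30)//.
  exact: (rate_bound d0 p2 n3 thetaP erefl erefl erefl).
have sums : {ae P, forall w, exists B : R, forall N, \sum_(k < N) f k w <= B}.
  apply: (@ae_bounded_sums _ _ _ P f (fun n => c3 * log_weight t n) (c3 * M)).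
  - by move=> n; have [] := fP n.
  - by move=> n w; have [] := fP n.
  - by move=> n; have [] := fP n.
  - by move=> N; rewrite -mulr_sumr ler_wpM2l// ltW.
have growth := abs_sum_growth p2 me st C3.
apply: filterS2 sums growth => w [B fB] [B' WB].
have B1 : 0 < `|B'| + 1 by rewrite ltr_wpDl.
apply: limn_esup_le; near=> n.
have n3 : (3 <= n)%N by near: n; exists 3%N.
have n0 : 0 < n%:R :> R by rewrite ltr0n (leq_trans _ n3).
have l0 : 0 < ln n%:R :> R by exact: ln_gt0_nat (ltnW n3).
have hn0 : 0 < h n by rewrite mulr_gt0// powR_gt0.
have gn : good n.
  rewrite /good n3 hn0 /=; apply/andP; split; near: n.
    move/cvgrPdist_le : h_cvg => /(_ (1 / 2)) H.
    have {}H := H ltac:(by []); apply: filterS H => n; rewrite sub0r normrN; exact: le_trans (ler_norm _).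
  by move/cvgryPge : nh_cvg; apply.
have fn : f n w <= 1.
  near: n; apply: (@bounded_sums_eventually_le1 _ (fun n => f n w) B) => // n.
  by have [] := fP n.
(* The growth constant [B'] depends on [w], but $h_n^d \ln^2 n$ tends to 0, so it only affects how
   large [n] must be. The 1 in [|B'| + 1] keeps the divisor positive. *)
have hW : h n ^+ d * (abs_sum eps n w / n%:R ^+ d) <= 1.
  have Hs : h n ^+ d * ln n%:R ^+ 2 <= (`|B'| + 1)^-1.
    by near: n; apply: bandwidth_log_small => //; rewrite invr_gt0.
  apply: (@le_trans _ _ (h n ^+ d * ((`|B'| + 1) * ln n%:R ^+ 2))).
    rewrite ler_wpM2l ?exprn_ge0 ?(ltW hn0)//; apply: le_trans (WB n n3) _.
    rewrite ler_wpM2r ?sqr_ge0//; apply: le_trans (ler_norm _) _; by rewrite lerDl.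
  by rewrite mulrCA -ler_pdivlMl// mulr1.
have vn := v_gt0 n gn.
apply: (@le_trans _ _ (((c1 + c2) * v n)%:E * ((v n)^-1)%:E)%E); last first.
  by rewrite -EFinM mulfK// gt_eqF.
rewrite lee_wpmul2r ?lee_fin ?invr_ge0 ?(ltW vn)//.
apply: ge_ereal_sup => _ [x xc <-]; rewrite lee_fin (g_est_center me st ieps E0).
have [_ _ _ fb] := fP n; apply: le_trans (fb gn w fn x xc) _.
rewrite [leRHS]mulrC ler_wpM2l ?(ltW vn)// lerD2l ler_piMr// ltW.
Unshelve. all: by end_near.
Qed.
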